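(* Suppose that $\phi$ satisfies Grey's condition. Then for any $t>0$, the function $r\mapsto u(r):=\bar u^\xi_{r,t}=\bar v^\xi_{r,t}$ on $[0,t)$ is the minimal positive continuous solution to $$\frac{d}{dr}u(r)=e^{\xi(r)}\phi(e^{-\xi(r)}u(r)),\qquad \text{a.e. } r\in(0,t),$$ with terminal condition $u(t-)=\infty$.
   Context: ''Positive'' means nonnegative, and $\int_a^b$ means $\int_{(a,b]}$. Branching mechanism: $b\in\mathbb{R}$, $c\ge 0$, $(z\wedge z^2)\,m(dz)$ is a finite measure on $(0,\infty)$, and $\phi(z)=bz+cz^2+\int_0^\infty(e^{-uz}-1+uz)\,m(du)$, $z\ge0$. We say $\phi$ satisfies Grey's condition if $\int_1^\infty\phi(z)^{-1}\,dz<\infty$. Environment: $(\Omega,\mathcal{F},\mathcal{F}_t,\mathbf{P})$ is a filtered probability space satisfying the usual hypotheses, and $\xi$ is an $(\mathcal{F}_t)$-Lévy process with Lévy–Itô decomposition $$\xi(t)=\xi(0)+at+\sigma B(t)+\int_0^t\int_{[-1,1]}z\,\tilde N(ds,dz)+\int_0^t\int_{\mathbb{R}\setminus[-1,1]}z\,N(ds,dz),$$ where $a\in\mathbb{R}$, $\sigma\ge0$, $B$ is an $(\mathcal{F}_t)$-Brownian motion, and $N$ is an $(\mathcal{F}_t)$-Poisson random measure on $(0,\infty)\times\mathbb{R}$ with intensity $ds\,\nu(dz)$ and compensated measure $\tilde N$, $\nu$ being a measure on $\mathbb{R}\setminus\{0\}$ with $\int(1\wedge z^2)\,\nu(dz)<\infty$.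 For $t\ge 0$ and $\lambda\ge0$, $r\mapsto u^\xi_{r,t}(\lambda)$ is the unique positive solution of $u^\xi_{r,t}(\lambda)=\lambda-\int_r^t e^{\xi(s)}\phi(e^{-\xi(s)}u^\xi_{s,t}(\lambda))\,ds$, $0\le r\le t$, and $v^\xi_{r,t}(\lambda)=e^{-\xi(r)}u^\xi_{r,t}(e^{\xi(t)}\lambda)$. Both are increasing in $\lambda$; for $0\le r<t$, $\bar u^\xi_{r,t}:=\lim_{\lambda\to\infty}u^\xi_{r,t}(\lambda)\in[0,\infty]$ and $\bar v^\xi_{r,t}:=\lim_{\lambda\to\infty}v^\xi_{r,t}(\lambda)\in[0,\infty]$. $u(t-)$ is the left limit at $t$; minimal means that any other positive continuous solution $w$ of the equation with $w(t-)=\infty$ satisfies $w\ge u$ on $[0,t)$.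
   Formalization: The equality ū=v̄ fails unless ξ(r)=0 and is corrected to u(r)=ū=e^{ξ(r)}v̄; continuous solutions are taken locally absolutely continuous (otherwise minimality fails); Grey's condition means that 1/φ is integrable on [1,∞). *)

(* Defs.v *)
From HB Require Import structures.
From mathcomp Require Import all_boot all_order all_algebra.
From mathcomp Require Import all_classical all_reals all_analysis.
From mathcomp Require Import measurable_realfun.

Set Implicit Arguments.
Unset Strict Implicit.
Unset Printing Implicit Defensive.

Import Order.TTheory GRing.Theory Num.Theory.
Import numFieldNormedType.Exports.

Local Open Scope classical_set_scope.
Local Open Scope ring_scope.

Section branching.
Context {R : realType}.
Implicit Types (phi xi u : R -> R) (m : {measure set R -> \bar R}).

(* Only the restriction of [m] to (0, +oo) is ever used. *)
Definition branching_parameters (c : R) m :=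
  0 <= c /\ (\int[m]_(z in `]0%R, +oo[) (Num.min z (z ^+ 2))%:E < +oo)%E.

Definition branching_mechanism (b c : R) m (z : R) : R :=
  b * z + c * z ^+ 2 +
  \int[m]_(u in `]0, +oo[) (expR (- (u * z)) - 1 + u * z).

(* The inverse is taken in \bar R, where 0^-1 = +oo, and integrability, rather
   than an inequality _ < +oo, is required: this rules out phi = 0 as well as
   mechanisms that are negative on part of [1, +oo). *)
Definition grey_condition phi : Prop :=
  (@lebesgue_measure R).-integrable `[1, +oo[ (fun z => ((phi z)%:E^-1)%E).

Definition environment_drift phi xi (r x : R) : R :=
  expR (xi r) * phi (expR (- xi r) * x).

Definition positive_backward_solution phi xi (t lambda : R) u :=
  [/\ {in `[0, t], forall r, 0 <= u r},
      (@lebesgue_measure R).-integrable `]0, t]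
        (fun s => (environment_drift phi xi s (u s))%:E) &
      {in `[0, t], forall r, u r =
        lambda - \int[lebesgue_measure]_(s in `]r, t])
                   environment_drift phi xi s (u s)}].

Definition unique_positive_backward_solution phi xi (t lambda : R) u :=
  positive_backward_solution phi xi t lambda u /\
  forall w, positive_backward_solution phi xi t lambda w ->
    {in `[0, t], w =1 u}.

(* In the next definitions [u r t lambda] stands for u_{r,t}(lambda). *)
Definition vflow xi (u : R -> R -> R -> R) (r t lambda : R) : R :=
  expR (- xi r) * u r t (expR (xi t) * lambda).

Definition flow_at_infinity (u : R -> R -> R -> R) (r t : R) : \bar R :=
  lim ((u r t lambda)%:E @[lambda --> +oo]).

Definition absolutely_continuous_on (a b : R) (f : R -> R) :=
  forall e : R, 0 < e -> exists2 delta : R, 0 < delta &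
    forall (n : nat) (x y : 'I_n -> R),
      (forall i, [/\ a <= x i, x i <= y i & y i <= b]) ->
      trivIset setT (fun i => `]x i, y i[%classic) ->
      \sum_(i < n) (y i - x i) < delta ->
      \sum_(i < n) `|f (y i) - f (x i)| < e.

(* A solution of an a.e. differential equation is understood in the sense of
   Caratheodory, hence locally absolutely continuous.  With mere continuity,
   singular (Cantor-like) increments could be added to a solution and no
   minimal solution would exist in general. *)
Definition explosive_solution phi xi (t : R) u :=
  [/\ {in `[0, t[, forall r, 0 <= u r},
      {within `[0, t[, continuous u},
      {in `[0, t[, forall s, absolutely_continuous_on 0 s u},
      {ae lebesgue_measure, forall r, r \in `]0, t[ ->
         is_derive r (1 : R) u (environment_drift phi xi r (u r))} &
      u r @[r --> t^'-] --> +oo].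

Definition minimal_explosive_solution phi xi (t : R) u :=
  explosive_solution phi xi t u /\
  forall w, explosive_solution phi xi t w -> {in `[0, t[, forall r, u r <= w r}.

End branching.

Section environment.
Context {R : realType} {d : measure_display} {Omega : measurableType d}.
Variables (P : probability Omega R) (F : R -> set (set Omega)).
Implicit Types (X xi B M : R -> Omega -> R) (nu : {measure set R -> \bar R})
  (N : Omega -> {measure set (R * R) -> \bar R}).

(* Time is the half-line [0, +oo); values at negative times are ignored. *)
Definition usual_filtration :=
  [/\ forall t : R, 0 <= t -> sigma_algebra setT (F t) /\ F t `<=` measurable,
      forall s t : R, 0 <= s -> s <= t -> F s `<=` F t,
      forall A, P.-negligible A -> F 0 A &
      forall t : R, 0 <= t -> F t = \bigcap_(s in [set s | t < s]) F s].

Definition adapted X :=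
  forall (t : R) (A : set R), 0 <= t -> measurable A -> F t (X t @^-1` A).

Definition increment X (s t : R) (w : Omega) : R := X t w - X s w.

Definition independent_increments X :=
  forall (s t : R) (E : set Omega) (A : set R), 0 <= s -> s <= t -> F s E -> measurable A ->
    P (E `&` increment X s t @^-1` A) = (P E * P (increment X s t @^-1` A))%E.

Definition cadlag (f : R -> R) :=
  (forall t : R, 0 <= t -> f s @[s --> t^'+] --> f t) /\
  (forall t : R, 0 < t -> exists l : R, f s @[s --> t^'-] --> l).

Definition levy_process xi :=
  [/\ adapted xi, forall w, cadlag (xi ^~ w), independent_increments xi &
      forall (s h : R) (A : set R), 0 <= s -> 0 <= h -> measurable A ->
        P (increment xi s (s + h) @^-1` A) = P (increment xi 0 h @^-1` A)].

Definition brownian_motion B :=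
  [/\ adapted B,
      forall w, B 0 w = 0 /\ {within `[0, +oo[, continuous (B ^~ w)},
      independent_increments B &
      forall (s t : R) (A : set R), 0 <= s -> s < t -> measurable A ->
        P (increment B s t @^-1` A) = normal_prob 0 (Num.sqrt (t - s)) A].

Definition levy_measure nu :=
  nu [set 0] = 0%E /\ (\int[nu]_z (Num.min 1 (z ^+ 2))%:E < +oo)%E.

Definition intensity nu (A : set (R * R)) : \bar R :=
  (lebesgue_measure \x nu)%E A.

(* The second clause contains the Poisson law of N(A), the independence over
   disjoint sets, and the independence of the past.  The weights are written
   out because the library's [poisson_pmf] is constantly 1 at rate 0. *)
Definition poisson_random_measure nu N :=
  (forall (t : R) (A : set (R * R)) (C : set (\bar R)),
     0 <= t -> measurable A -> A `<=` `]0, t] `*` setT -> measurable C ->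
     F t ((fun w => N w A) @^-1` C)) /\
  (forall (s : R) (E : set Omega) (n : nat) (A : 'I_n -> set (R * R))
       (k : 'I_n -> nat),
     0 <= s -> F s E ->
     (forall i, [/\ measurable (A i), A i `<=` `]s, +oo[ `*` setT &
                    (intensity nu (A i) < +oo)%E]) ->
     trivIset setT A ->
     P (E `&` [set w | forall i, N w (A i) = (k i)%:R%:E]) =
     (P E * (\prod_(i < n) (expR (- fine (intensity nu (A i))) *
               fine (intensity nu (A i)) ^+ k i / (k i)`!%:R))%:E)%E).

Definition large_jumps N (t : R) (w : Omega) : R :=
  \int[N w]_(p in `]0, t] `*` ~` `[-1, 1]) p.2.

Definition compensated_jumps nu N (eps t : R) (w : Omega) : R :=
  \int[N w]_(p in `]0, t] `*` [set z | eps < `|z| <= 1]) p.2 -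
  t * \int[nu]_(z in [set z | eps < `|z| <= 1]) z.

(* The integral of z over (0, t] x [-1, 1] against the compensated measure is
   the L^2 limit of the integrals over eps < |z| <= 1. *)
Definition compensated_integral nu N M :=
  adapted M /\
  forall t : R, 0 <= t ->
    (\int[P]_w ((M t w - compensated_jumps nu N eps t w) ^+ 2)%:E)%E
      @[eps --> 0^'+] --> 0%E.

Definition levy_environment (a sigma : R) B nu N xi :=
  [/\ levy_process xi, 0 <= sigma, brownian_motion B,
      levy_measure nu /\ poisson_random_measure nu N &
      exists2 M, compensated_integral nu N M &
        forall t : R, 0 <= t -> {ae P, forall w,
          xi t w = xi 0 w + a * t + sigma * B t w + M t w + large_jumps N t w}].

End environment.

(* Main.v *)
Require Import Defs.
From HB Require Import structures.
From mathcomp Require Import all_boot all_order all_algebra.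
From mathcomp Require Import all_classical all_reals all_analysis.
From mathcomp Require Import measurable_realfun.
From mathcomp Require Import ring lra.

Set Implicit Arguments.
Unset Strict Implicit.
Unset Printing Implicit Defensive.

Import Order.TTheory GRing.Theory Num.Theory.
Import numFieldNormedType.Exports.
Local Open Scope classical_set_scope.
Local Open Scope ring_scope.

(** The statement is about one environment at a time: once the sample point is
    fixed, the environment enters only through its path [xi], of which the
    proof uses that it is cadlag, hence bounded and measurable on bounded time
    intervals.  Two properties of the branching mechanism [phi] are used: it is
    continuous on the half-line, and, being convex with [phi 0 = 0], it is
    star-shaped, [phi (theta z) <= theta (phi z)] for [theta] in [0, 1].

    Finiteness.  By star-shapedness, if [|xi| <= K] on [0, t] and
    [M = exp K], then the drift at [v] dominates [M * phi (v / M)], so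
    [x = u / M] satisfies [x' >= phi x] for every solution [u].  The
    separation of variables [dx / phi x >= dr] bounds the remaining time
    [t - r] by a fixed multiple of the integral of [1 / phi] over
    [(x r, +oo)].  Under Grey's condition this integral vanishes as [x r]
    grows, which bounds [u r] uniformly in the terminal value
    ([integral_solution_bound]).

    Comparison.  Gronwall's inequality is replaced by the assumed uniqueness of
    the backward solutions.  If [u <= w] fails at some time although [u <= w]
    later, the two paths meet in between; following [w] before the meeting time
    and [u] after it yields a second solution with the terminal value of [u]
    ([unique_solution_comparison]).  Hence the flow is nondecreasing in the
    terminal value and its limit [U] is a supremum.

    Explosion.  Bounded convergence transports the integral equation to [U] on
    every [[0, s]] with [s < t]; its drift is bounded there, so [U] is Lipschitz
    on [[0, s]] and solves the differential equation almost everywhere.  It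
    tends to [+oo] at [t] since it dominates every solution.

    Minimality.  An explosive solution [w] solves the integral equation on
    [[0, s]], because an absolutely continuous function with almost everywhere
    null derivative is constant ([absolutely_continuous_derive0]).  Near [t]
    it exceeds any given backward solution, which is bounded, so by comparison
    it does so at all earlier times; taking the supremum gives [U <= w]. *)

(** * Segments of the real line *)

Section chaining.
Context {R : realType}.
Implicit Types (f : R -> R) (a b : R).

(** Compactness of the segment, in the form of Cousin's lemma: a transitive
    relation that holds between each point and its neighbours on either side
    propagates from one end to the other. It turns local bounds into global
    ones. *)
Lemma interval_chaining (P : R -> R -> Prop) a b : a <= b ->
  (forall x y z, a <= x -> x <= y -> y <= z -> z <= b ->
    P x y -> P y z -> P x z) ->
  (forall p, a <= p <= b -> exists2 d, 0 < d & forall q, a <= q <= b ->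
    `|q - p| < d -> (q <= p -> P q p) /\ (p <= q -> P p q)) ->
  P a b.
Proof.
move=> ab trP locP.
have refP p : a <= p <= b -> P p p.
  move=> pab; have [d d0 /(_ p pab)] := locP p pab.
  by rewrite subrr normr0 => /(_ d0)[] /(_ (lexx _)).
pose S := [set x | a <= x <= b /\ P a x].
have Sa : S a by split; [rewrite lexx|apply: refP; rewrite lexx].
have ubS : has_ubound S by exists b => x [/andP[]].
have supS : has_sup S by split => //; exists a.
have asup : a <= sup S by apply: ub_le_sup.
have supb : sup S <= b by apply: ge_sup; [exists a|move=> x [/andP[]]].
have [d d0 locs] := locP (sup S) (introT andP (conj asup supb)).
have Psup : P a (sup S).
  have [x [/andP[ax xb] Pax] dx] := sup_adherent d0 supS.
  have xs : x <= sup S by apply: ub_le_sup => //; split => //; rewrite ax.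
  apply: (trP _ x) => //.
  apply: (locs x _ _).1 => //; first by rewrite ax.
  by rewrite distrC ger0_norm ?subr_ge0// ltrBlDr addrC -ltrBlDr.
have [sb|bs] := ltP (sup S) b; last first.
  by have <- : sup S = b by apply/le_anti/andP.
pose q := Num.min b (sup S + d / 2).
have sq : sup S < q by rewrite lt_min sb ltrDl divr_gt0.
have qb : q <= b by rewrite ge_min lexx.
have aq : a <= q by rewrite (le_trans asup)// ltW.
have Sq : S q.
  split; first by rewrite aq.
  apply: (trP _ (sup S)) => //; first exact: ltW.
  apply: (locs q _ _).2; rewrite ?aq ?(ltW sq)//.
  rewrite gtr0_norm ?subr_gt0// ltrBlDl.
  by rewrite (@le_lt_trans _ _ (sup S + d / 2))// ?ge_min ?lexx ?orbT//; lra.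
by have := ub_le_sup ubS Sq; rewrite leNgt sq.
Qed.

Lemma within_continuous_distP (A : set R) f : {within A, continuous f} <->
  forall p, A p -> forall e, 0 < e -> exists2 d, 0 < d &
    forall q, A q -> `|q - p| < d -> `|f q - f p| < e.
Proof.
split=> [/subspace_continuousP cf p Ap e e0|cf].
  have /cvgrPdist_lt/(_ e e0) := cf p Ap.
  move=> /nbhs_ballP[d /= d0 hd]; exists d => // q Aq qp.
  by rewrite distrC; apply: hd => //; rewrite /ball/= distrC.
apply/subspace_continuousP => p Ap; apply/cvgrPdist_lt => e e0.
have [d d0 hd] := cf p Ap e e0.
apply/nbhs_ballP; exists d => //= q; rewrite /ball/= distrC => qp Aq.
by rewrite distrC; exact: hd.
Qed.

(** Unlike the intermediate value theorem, this gives the first zero, before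
    which the sign of [f] is known. *)
Lemma first_exit f a b : a <= b -> {within `[a, b], continuous f} ->
  0 < f a -> f b <= 0 ->
  exists c, [/\ a <= c <= b, f c = 0 & forall x, a <= x < c -> 0 < f x].
Proof.
move=> ab /within_continuous_distP cf fa fb.
pose S := [set x | a <= x <= b /\ f x <= 0].
have Sb : S b by split => //; rewrite lexx ab.
have lbS : has_lbound S by exists a => x [/andP[]].
have infS : has_inf S by split => //; exists b.
have ai : a <= inf S by apply: lb_le_inf; [exists b|move=> x [/andP[]]].
have ib : inf S <= b by apply: ge_inf.
have fpos x : a <= x < inf S -> 0 < f x.
  move=> /andP[ax xi]; rewrite ltNge; apply/negP => fx.
  suff : inf S <= x by rewrite leNgt xi.
  by apply: ge_inf => //; split => //; rewrite ax (le_trans (ltW xi)).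
have iab : `[a, b]%classic (inf S) by rewrite /= in_itv/= ai.
exists (inf S); split; [by rewrite ai| |by []].
have [fi|fi|//] := ltgtP (f (inf S)) 0.
- have [d d0 hd] := cf _ iab (- f (inf S)) ltac:(by rewrite oppr_gt0).
  have {}ai : a < inf S.
    by rewrite lt_neqAle ai andbT; apply: contraTneq fi => <-; rewrite -leNgt ltW.
  pose x := Num.max a (inf S - d / 2).
  have xi : x < inf S by rewrite gt_max ai; lra.
  have ax : a <= x by rewrite le_max lexx.
  have := hd x; rewrite /= in_itv/= ax (le_trans (ltW xi) ib) => /(_ isT).
  have -> : `|x - inf S| < d.
    rewrite ltr0_norm ?subr_lt0// opprB ltrBlDr -ltrBlDl lt_max.
    by apply/orP; right; lra.
  by move=> /(_ isT); have := fpos x; rewrite ax xi => /(_ isT); rewrite ltr_norml; lra.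
- have [d d0 hd] := cf _ iab _ fi.
  have [x [xab fx] xi] := inf_adherent d0 infS.
  have ix : inf S <= x by apply: ge_inf.
  have := hd x; rewrite /= in_itv/= => /(_ xab).
  rewrite ger0_norm ?subr_ge0// ltrBlDl => /(_ xi).
  by rewrite ltr_norml => /andP[]; lra.
Qed.

Lemma bounded_of_locally_bounded f a b : a <= b ->
  (forall p, a <= p <= b -> exists2 d, 0 < d & exists M, forall q,
    a <= q <= b -> `|q - p| < d -> `|f q| <= M) ->
  exists M, forall q, a <= q <= b -> `|f q| <= M.
Proof.
move=> ab loc.
pose P x y := exists M, forall q, x <= q <= y -> `|f q| <= M.
apply: (@interval_chaining P a b ab).
  move=> x y z ax xy yz zb [M hM] [N hN]; exists (Num.max M N) => q.
  move=> /andP[xq qz]; rewrite le_max.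
  by have [qy|yq] := leP q y; [rewrite hM ?xq|rewrite hN ?orbT ?(ltW yq)].
move=> p /andP[ap pb]; have [d d0 [M hM]] := loc p (introT andP (conj ap pb)).
exists d => // q /andP[aq qb] qp; split => [lqp|lpq]; exists M => r /andP[h1 h2];
  apply: hM.
- by rewrite (le_trans aq h1) (le_trans h2 pb).
- apply: le_lt_trans qp; rewrite ler_norml; apply/andP; split.
    by rewrite ler0_norm ?subr_le0// opprK lerB.
  by rewrite (@le_trans _ _ 0)// subr_le0.
- by rewrite (le_trans ap h1) (le_trans h2 qb).
- apply: le_lt_trans qp; rewrite ler_norml; apply/andP; split.
    by rewrite (@le_trans _ _ 0)// ?oppr_le0// subr_ge0.
  by rewrite ger0_norm ?subr_ge0// lerB.
Qed.

Lemma nondecreasing_cvg_sup (f : R -> R) :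
  (forall x y, 0 <= x -> x <= y -> f x <= f y) ->
  has_ubound [set f x | x in `[0, +oo[] ->
  f x @[x --> +oo] --> sup [set f x | x in `[0, +oo[].
Proof.
move=> ndf ub; set S := [set f x | x in _] in ub *.
have S0 : S (f 0) by exists 0; rewrite //= in_itv/= lexx.
have supS : has_sup S by split => //; exists (f 0).
apply/cvgrPdist_lt => e e0.
have [_ [x0 /= + <-] fx0] := sup_adherent e0 supS.
rewrite in_itv/= andbT => x00.
near=> x; have x0x : x0 <= x by near: x; exact: nbhs_pinfty_ge (num_real _).
have fxS : f x <= sup S.
  by apply: ub_le_sup => //; exists x => //=; rewrite in_itv/= andbT (le_trans x00).
rewrite ger0_norm ?subr_ge0// ltrBlDl -ltrBlDr.
by rewrite (lt_le_trans fx0)// ndf.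
Unshelve. all: by end_near. Qed.

End chaining.

(** * Absolutely continuous functions *)

Section absolute_continuity.
Context {R : realType}.
Implicit Types (f g h : R -> R) (a b C : R).
Notation mu := (@lebesgue_measure R).

Lemma lipschitz_absolutely_continuous f a b C :
  (forall x y, a <= x -> x <= y -> y <= b -> `|f y - f x| <= C * (y - x)) ->
  absolutely_continuous_on a b f.
Proof.
move=> lip e e0; have C0 : 0 < `|C| + 1 by rewrite ltr_wpDl.
exists (e / (`|C| + 1)); first exact: divr_gt0.
move=> n x y xy _ d; have CC : C <= `|C| + 1 by have := ler_norm C; lra.
apply: (@le_lt_trans _ _ ((`|C| + 1) * \sum_(i < n) (y i - x i))).
  rewrite mulr_sumr; apply: ler_sum => i _; have [ax lxy yb] := xy i.
  by rewrite (le_trans (lip _ _ ax lxy yb))// ler_wpM2r// subr_ge0.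
by rewrite mulrC -ltr_pdivlMr.
Qed.

Lemma absolutely_continuousB f g a b : absolutely_continuous_on a b f ->
  absolutely_continuous_on a b g ->
  absolutely_continuous_on a b (fun x => f x - g x).
Proof.
move=> acf acg e e0; have e20 : 0 < e / 2 by rewrite divr_gt0.
have [d1 d10 h1] := acf _ e20; have [d2 d20 h2] := acg _ e20.
exists (Num.min d1 d2); first by rewrite lt_min d10.
move=> n x y xy tr; rewrite lt_min => /andP[l1 l2].
rewrite (splitr e); apply: le_lt_trans (ltrD (h1 n x y xy tr l1) (h2 n x y xy tr l2)).
rewrite -big_split/=; apply: ler_sum => i _.
rewrite (_ : _ - _ = (f (y i) - f (x i)) - (g (y i) - g (x i))); last by ring.
exact: ler_normB.
Qed.

Lemma absolutely_continuousS f a b a' b' : a <= a' -> b' <= b ->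
  absolutely_continuous_on a b f -> absolutely_continuous_on a' b' f.
Proof.
move=> aa bb ac e e0; have [d d0 h] := ac e e0; exists d => // n x y xy.
apply: h => i; have [h1 h2 h3] := xy i; split => //.
  exact: le_trans h1.
exact: le_trans bb.
Qed.

(** Paths for [good] are chained instead of [good] itself, which need not be
    transitive. The sequence is extended by the constant [b] after [n] so that
    it is monotone on all of [nat]. *)
Lemma interval_partition (good : rel R) a b : a <= b ->
  (forall p, a <= p <= b -> exists2 d, 0 < d & forall q, a <= q <= b ->
    `|q - p| < d -> (q <= p -> good q p) /\ (p <= q -> good p q)) ->
  (forall p q, good p q -> p <= q) ->
  exists n (x : nat -> R), [/\ x 0%N = a, x n = b,
    {homo x : i j / (i <= j)%N >-> i <= j} &
    forall i, (i < n)%N -> good (x i) (x i.+1)].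
Proof.
move=> ab loc goodle.
have [s [gs sb]] : exists s, path good a s /\ last a s = b.
  apply: (@interval_chaining _ (fun x y =>
    exists s, path good x s /\ last x s = y)) => //.
    move=> x y z _ _ _ _ [s [gs sy]] [t [gt tz]]; exists (s ++ t).
    by rewrite cat_path gs sy gt last_cat sy tz.
  move=> p pab; have [d d0 hd] := loc p pab; exists d => // q qab qp.
  have [qp1 pq1] := hd q qab qp; split => lpq.
    by exists [:: p]; rewrite /= qp1.
  by exists [:: q]; rewrite /= pq1.
exists (size s), (nth b (a :: s)).
have gx i : (i < size s)%N -> good (nth b (a :: s) i) (nth b (a :: s) i.+1).
  by move=> si; exact: (pathP b gs).
have nthb : nth b (a :: s) (size s) = b.
  by rewrite -[size s]/(size (a :: s)).-1 nth_last.
split => //.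
apply/nondecreasing_seqP => i.
have [si|si] := ltnP i (size s); first exact/goodle/gx.
rewrite [leRHS]nth_default//= [leLHS](_ : _ = b)//.
move: si; rewrite leq_eqVlt => /predU1P[<-//|si].
by rewrite nth_default.
Qed.

(** Cover the exceptional null set, together with the end points, by an open
    set [U] of small measure. Each point has a neighbourhood that
    either lies in [U], or on which the increments of [h] from that point are at
    most [e] times the length. In a partition subordinate to these
    neighbourhoods the intervals inside [U] are disjoint of small total length
    and contribute at most [e] by absolute continuity, while the others
    contribute at most [e * (b - a)]. *)
Lemma absolutely_continuous_derive0 a b h : a <= b ->
  absolutely_continuous_on a b h ->
  {ae mu, forall r, r \in `]a, b[ -> is_derive r (1 : R) h 0} ->
  h b = h a.
Proof.
move=> ab ach [N [mN N0 dN]].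
apply/eqP; rewrite -subr_eq0 -normr_le0; apply/ler_addgt0Pr => e0 e00.
rewrite add0r.
(* The final estimate is e * (b - a) + 2 * e. *)
pose e := e0 / (b - a + 2).
have e_gt0 : 0 < e by rewrite divr_gt0//; lra.
have -> : e0 = e * (b - a) + 2 * e.
  by rewrite -(mulrC e) -mulrDr /e divfK//; lra.
have {ach}[d d0 ach] := ach e e_gt0.
pose E : set R := N `|` [set a; b].
have mE : measurable E by apply: measurableU => //; exact: measurableU.
have E0 : mu E = 0%E.
  have s0 x : mu [set x] = 0%E by exact: lebesgue_measure_set1.
  rewrite /E measureU0//; last by rewrite measureU0//; exact: s0.
  exact: measurableU.
have Ey : (mu E < +oo)%E by rewrite E0.
have [U [oU NU Ud]] := lebesgue_regularity_outer mE Ey d0.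
have mU : measurable U := open_measurable oU.
have {}Ud : (mu U < d%:E)%E.
  have mUE : measurable (U `\` E) by exact: measurableD.
  have -> : mu U = mu (U `\` E).
    by rewrite -[in LHS](setDUK NU) setUC measureU0.
  exact: Ud.
pose good p q := [&& p <= q &
  `[< `|h q - h p| <= e * (q - p) >] || `[< `]p, q]%classic `<=` U >]].
have [|p q /andP[]//|n [x [x0 xn ndx gx]]] := @interval_partition good a b ab.
  move=> p /andP[ap pb].
  have [Up|NUp] := pselect (U p).
    have [d1 /= d10 hd1] := (nbhs_ballP _ _).1 (open_nbhs_nbhs (conj oU Up)).
    exists d1 => // q _ qp; split => lpq; rewrite /good lpq /=;
      apply/orP; right; apply/asboolP => z /=; rewrite in_itv/= => /andP[z1 z2];
      apply: hd1; rewrite /ball/=.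
    + move: qp; rewrite ler0_norm ?subr_le0// ger0_norm ?subr_ge0//; lra.
    + move: qp; rewrite ger0_norm ?subr_ge0// ler0_norm ?subr_le0 1?ltW//; lra.
  have der : is_derive p (1 : R) h 0.
    have [Np|] := pselect (N p); first by exfalso; apply/NUp/NU; left.
    move=> NNp; have : ~ ~ (p \in `]a, b[ -> is_derive p (1 : R) h 0).
      by move=> /dN.
    move/contrapT; apply.
    rewrite in_itv/= !lt_neqAle ap pb !andbT; apply/andP; split.
      by apply/eqP => pa; apply/NUp/NU; right; left.
    by apply/eqP => pa; apply/NUp/NU; right; right.
  have [d1 /= d10 hd1] : exists2 d1, 0 < d1 & forall q, `|q - p| < d1 ->
      `|h q - h p| <= e * `|q - p|.
    have /is_derive1_caratheodory [g [hg cg gp]] := der.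
    have /cvgrPdist_lt/(_ e e_gt0)/nbhs_ballP[d1 /= d10 hd1] := cg.
    exists d1 => // q qp; rewrite hg normrM ler_wpM2r//.
    have := hd1 q; rewrite /ball/= distrC gp sub0r normrN => /(_ qp).
    exact: ltW.
  exists d1 => // q _ qp; split => lpq; rewrite /good lpq /=;
      apply/orP; left; apply/asboolP.
  + by rewrite distrC (le_trans (hd1 q qp))// distrC ger0_norm ?subr_ge0.
  + by rewrite (le_trans (hd1 q qp))// ger0_norm ?subr_ge0.
pose inU (i : nat) := `[< `]x i, x i.+1]%classic `<=` U >].
(* Intervals of the first kind are collapsed to points, which leaves a family
   contained in U indexed by the whole partition. *)
pose y (i : nat) := if inU i then x i.+1 else x i.
have xy i : x i <= y i by rewrite /y; case: ifP => _; [exact: ndx|].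
have yx i : y i <= x i.+1 by rewrite /y; case: ifP => _; [|exact: ndx].
have tr : trivIset setT (fun i : 'I_n => `]x i, y i[%classic).
  apply/trivIsetP => i j _ _; wlog ij : i j / (i < j)%N.
    move=> wl ij; have : val i != val j by [].
    rewrite neq_ltn => /orP[|] lij; first exact: wl.
    by rewrite setIC; apply: wl => //; rewrite eq_sym.
  move=> _; apply/seteqP; split => // z [] /=; rewrite !in_itv/=.
  move=> /andP[_ zi] /andP[zj _].
  by have := le_lt_trans (le_trans (yx i) (ndx _ _ ij)) zj; rewrite ltNge (ltW zi).
have suml : \sum_(i < n) (y i - x i) < d.
  rewrite -lte_fin; apply: le_lt_trans Ud.
  rewrite -sumEFin.
  under eq_bigr => i _.
    rewrite (_ : (y i - x i)%:E = mu `]x i, y i[); last first.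
      rewrite lebesgue_measure_itv/= lte_fin; case: ltP => // yxi.
      suff -> : y i = x i by rewrite subrr.
      by apply/le_anti; rewrite xy yxi.
    over.
  have mbig : measurable (\big[setU/set0]_(k < n) `]x k, y k[%classic).
    by apply: bigsetU_measurable => i _.
  rewrite -measure_semi_additive_ord//=.
  apply: le_measure; rewrite ?inE//; elim/big_rec: _ => [|i A _ AU]; first exact: sub0set.
  rewrite subUset; split=> // z; rewrite /y; case: ifPn => [/asboolP iU|_].
    by move=> zi; apply: iU; move: zi; rewrite /= !in_itv/= => /andP[-> /ltW].
  by rewrite set_itvoo0.
have {}ach : \sum_(i < n) `|h (y i) - h (x i)| < e.
  apply: (ach n) => // i; split => //.
    by rewrite -x0 ndx.
  by rewrite (le_trans (yx i))// -xn ndx.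
have hba : h b - h a = \sum_(i < n) (h (x i.+1) - h (x i)).
  by rewrite -(big_mkord xpredT (fun i => h (x i.+1) - h (x i))) telescope_sumr// xn x0.
have -> : b - a = \sum_(i < n) (x i.+1 - x i).
  by rewrite -(big_mkord xpredT (fun i => x i.+1 - x i)) telescope_sumr// xn x0.
rewrite hba (le_trans (ler_norm_sum _ _ _))// mulr_sumr.
apply: (@le_trans _ _ (\sum_(i < n) (e * (x i.+1 - x i) + `|h (y i) - h (x i)|))).
  apply: ler_sum => i _; rewrite /y; case: ifPn => [_|iU].
    by rewrite lerDr mulr_ge0 ?(ltW e_gt0)// subr_ge0 ndx.
  have /andP[_ /orP[/asboolP gi|]] := gx i (ltn_ord i).
    by rewrite subrr normr0 addr0.
  by rewrite (negbTE (iU : ~~ `[< _ >])).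
by rewrite big_split/= lerD2l (le_trans (ltW ach))//; lra.
Qed.

End absolute_continuity.

(** * Integrals over intervals *)

Section interval_integrals.
Context {R : realType}.
Implicit Types (g h : R -> R) (a b c x y : R).
Notation mu := (@lebesgue_measure R).

Lemma integrable_subitv g a b x y : a <= x -> y <= b ->
  mu.-integrable `]a, b] (EFin \o g) -> mu.-integrable `]x, y] (EFin \o g).
Proof.
move=> ax yb; apply: integrableS => //.
by apply: subset_itv; rewrite bnd_simp.
Qed.

Lemma integrable_itv_cat g a b c : mu.-integrable `]a, b] (EFin \o g) ->
  mu.-integrable `]b, c] (EFin \o g) -> mu.-integrable `]a, c] (EFin \o g).
Proof.
move=> iab ibc.
have restr x y : mu.-integrable `]x, y] (EFin \o g) ->
    mu.-integrable setT (EFin \o g \_ `]x, y]).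
  by move=> ?; rewrite -restrict_EFin; apply/integrable_restrict => //=;
    rewrite setTI.
have isum := integrableD measurableT (restr _ _ iab) (restr _ _ ibc).
have {}isum : mu.-integrable `]a, c]
    ((EFin \o g \_ `]a, b]) \+ (EFin \o g \_ `]b, c]))%E.
  exact: integrableS isum.
apply: eq_integrable isum => // s; rewrite inE/= in_itv/= => /andP[sa sc].
rewrite /= !patchE.
have [sb|bs] := leP s b.
  rewrite mem_set/= ?in_itv/= ?sa// memNset/= ?in_itv/= ?adde0//.
  by apply/negP; rewrite negb_and -leNgt sb.
rewrite memNset/= ?in_itv/= ?mem_set/= ?in_itv/= ?bs ?add0e//.
by apply/negP; rewrite negb_and -ltNge bs orbT.
Qed.

Lemma integral_chasles g a b c : a <= b -> b <= c ->
  mu.-integrable `]a, c] (EFin \o g) ->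
  \int[mu]_(s in `]a, c]) g s =
  \int[mu]_(s in `]a, b]) g s + \int[mu]_(s in `]b, c]) g s.
Proof.
move=> ab bc ig; have := @Rintegral_itvB _ g (BRight a) (BRight c) b ig.
by rewrite !bnd_simp => /(_ ab bc) <-; rewrite addrC subrK.
Qed.

Lemma integral_itv_cst a b c : a <= b ->
  \int[mu]_(s in `]a, b]) c = c * (b - a).
Proof.
move=> ab; rewrite Rintegral_cst//= lebesgue_measure_itv/= lte_fin.
by move: ab; rewrite le_eqVlt => /predU1P[->|->]; rewrite ?ltxx ?subrr.
Qed.

Lemma integrable_bounded_itv g a b c : measurable_fun `]a, b] g ->
  (forall s, a < s <= b -> `|g s| <= c) -> mu.-integrable `]a, b] (EFin \o g).
Proof.
move=> mg gc; apply: measurable_bounded_integrable => //.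
  by rewrite /= lebesgue_measure_itv; case: ifP => //= _; rewrite -EFinD ltry.
exists c; split; first exact: num_real.
move=> M cM s /=; rewrite in_itv/= => sab.
by rewrite (le_trans (gc s sab))// ltW.
Qed.

Lemma integrable_itv_cst a b c : mu.-integrable `]a, b] (EFin \o cst c).
Proof. by apply: (@integrable_bounded_itv _ _ _ `|c|). Qed.

Lemma integral_itv_ge g a b c : a <= b -> mu.-integrable `]a, b] (EFin \o g) ->
  (forall s, a < s <= b -> c <= g s) ->
  c * (b - a) <= \int[mu]_(s in `]a, b]) g s.
Proof.
move=> ab ig cg; rewrite -integral_itv_cst//; apply: le_Rintegral => //.
  exact: integrable_itv_cst.
Qed.

Lemma integral_itv_norm_le g a b c : a <= b ->
  mu.-integrable `]a, b] (EFin \o g) ->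
  (forall s, a < s <= b -> `|g s| <= c) ->
  `|\int[mu]_(s in `]a, b]) g s| <= c * (b - a).
Proof.
move=> ab ig gc; rewrite -integral_itv_cst//.
apply: (le_trans (le_normr_Rintegral _ _)) => //.
apply: le_Rintegral; last by move=> s /=; rewrite in_itv/=; exact: gc.
- by [].
- exact: (integrable_abse ig).
- exact: integrable_itv_cst.
Qed.

Lemma integral_itv_small g a b e : mu.-integrable `]a, b] (EFin \o g) ->
  0 < e -> exists2 d, 0 < d & forall x y, a <= x -> x <= y -> y <= b ->
    y - x < d -> `|\int[mu]_(s in `]x, y]) g s| < e.
Proof.
move=> ig e0; have : mu.-integrable setT (EFin \o g \_ `]a, b]).
  by rewrite -restrict_EFin; apply/integrable_restrict => //=; rewrite setTI.
move=> /integral_normr_continuous /(_ _ e0)[d [d0 /= hd]].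
exists d => // x y ax xy yb yxd.
have ixy := integrable_subitv ax yb ig.
apply: (le_lt_trans (le_normr_Rintegral _ _)) => //.
have -> : \int[mu]_(s in `]x, y]) `|g s| =
    \int[mu]_(s in `]x, y]) `|(g \_ `]a, b]) s|.
  apply: eq_Rintegral => s; rewrite inE/= in_itv/= => /andP[xs sy].
  by rewrite patchE mem_set//= in_itv/= (le_lt_trans ax)// (le_trans sy).
apply: hd => //; rewrite lebesgue_measure_itv/=; case: ifP => _.
  by rewrite -EFinD lte_fin.
by rewrite lte_fin.
Qed.

Lemma integral_increments_continuous g h a b :
  mu.-integrable `]a, b] (EFin \o g) ->
  (forall x y, a <= x -> x <= y -> y <= b ->
    h y - h x = \int[mu]_(s in `]x, y]) g s) ->
  {within `[a, b], continuous h}.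
Proof.
move=> ig hg; apply/within_continuous_distP => p; rewrite /= in_itv/=.
move=> /andP[ap pb] e e0; have [d d0 hd] := integral_itv_small ig e0.
exists d => // q; rewrite /= in_itv/= => /andP[aq qb].
have [qp|/ltW pq] := leP q p.
- rewrite ler0_norm ?subr_le0// opprB => qpd.
  by rewrite distrC hg//; exact: hd.
- by rewrite ger0_norm ?subr_ge0// => qpd; rewrite hg//; exact: hd.
Qed.

(** The first fundamental theorem of calculus, stated for a function known by
    its increments on [[a, b]] only, so that it applies to solutions of
    integral equations without extending them. *)
Lemma integral_increments_derive g h a b :
  mu.-integrable `]a, b] (EFin \o g) ->
  (forall x y, a <= x -> x <= y -> y <= b ->
    h y - h x = \int[mu]_(s in `]x, y]) g s) ->
  {ae mu, forall r, r \in `]a, b[ -> is_derive r (1 : R) h (g r)}.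
Proof.
move=> ig hg; pose f := g \_ `]a, b].
have fi : mu.-integrable setT (EFin \o f).
  by rewrite -restrict_EFin; apply/integrable_restrict => //=; rewrite setTI.
have fiy y : mu.-integrable `]a, y] (EFin \o f) by apply: integrableS fi.
have := @FTC1 R f (BRight a) fiy (open_integrable_locally openT fi).
apply: filterS; first exact: (ae_filter_ringOfSetsType mu).
move=> r hr; rewrite in_itv/= => /andP[ar rb].
have [|df dv] := hr; first by rewrite /= lte_fin.
have : is_derive r (1 : R) (fun x => \int[mu]_(t in `]a, x]) f t + h a) (g r).
  rewrite -[g r]addr0; apply: is_deriveD; apply: DeriveDef => //.
  rewrite -derive1E dv /f patchE mem_set//= in_itv/= ar.
  exact: ltW.
apply: near_eq_is_derive.
near=> x; have /andP[ax xb] : a <= x <= b.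
  have : x \in `]a, b[ by near: x; apply: near_in_itvoo; rewrite in_itv/= ar.
  by rewrite in_itv/= => /andP[/ltW -> /ltW ->].
rewrite -[RHS](subrK (h a)) hg//; congr (_ + _).
apply: eq_Rintegral => s; rewrite inE/= in_itv/= => /andP[xs sy].
by rewrite /f patchE mem_set//= in_itv/= xs (le_trans sy).
Unshelve. all: by end_near. Qed.

Lemma bounded_convergence_itv (g_ : nat -> R -> R) g a b c :
  (forall n, measurable_fun `]a, b] (g_ n)) ->
  (forall n s, a < s <= b -> `|g_ n s| <= c) ->
  (forall s, a < s <= b -> g_ n s @[n --> \oo] --> g s) ->
  mu.-integrable `]a, b] (EFin \o g) /\
  \int[mu]_(s in `]a, b]) g_ n s @[n --> \oo] --> \int[mu]_(s in `]a, b]) g s.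
Proof.
move=> mg gc gg.
have mlim : measurable_fun `]a, b] g.
  exact: (@measurable_fun_cvg _ _ _ _ g_).
have [|||||ig _ cv] := @dominated_convergence _ _ R mu `]a, b]%classic
  (measurable_itv _) (fun n => EFin \o g_ n) (EFin \o g) (EFin \o cst c).
- by move=> n; apply/measurable_EFinP; exact: mg.
- by apply/measurable_EFinP; exact: mlim.
- apply: aeW => s; rewrite set_itvE => sab.
  by apply: cvg_EFin; [exact: nearW|exact: gg].
- exact: integrable_itv_cst.
- by apply: aeW => s n; rewrite set_itvE => sab; rewrite lee_fin; exact: gc.
split => //.
move: cv; rewrite -[X in _ --> X]fineK; last exact: integrable_fin_num ig.
by move/fine_cvg.
Qed.

End interval_integrals.

(** * The branching mechanism *)

Section branching_mechanism.
Context {R : realType}.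
Implicit Types (phi : R -> R) (x y z b c : R) (m : {measure set R -> \bar R}).

Definition star_shaped phi := forall theta z, 0 <= theta <= 1 -> 0 <= z ->
  phi (theta * z) <= theta * phi z.

(** The kernel of the jump part of the branching mechanism, at [y = u * z]. *)
Let g (y : R) := expR (- y) - 1 + y.

Let g_increment x y : 0 <= x -> x <= y ->
  0 <= g y - g x <= (y - x) * Num.min 1 y.
Proof.
move=> x0 xy; have y0 := le_trans x0 xy.
have -> : g y - g x = expR (- y) - expR (- x) + (y - x) by rewrite /g; ring.
have ex1 : expR (- x) <= 1 by rewrite -expR0 ler_expR lerNl oppr0.
have yx : expR (- y) = expR (- x) * expR (x - y).
  by rewrite -expRD; congr expR; ring.
have ex0 := expR_gt0 (- x); have ey0 := expR_gt0 (- y).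
have xy' : expR (- x) = expR (- y) * expR (y - x).
  by rewrite -expRD; congr expR; ring.
have h1 := expR_ge1Dx (x - y); have h2 := expR_ge1Dx (y - x).
have h3 := expR_ge1Dx (- y).
apply/andP; split; first by rewrite yx; nra.
rewrite minEle; case: ifP => _; last by rewrite [X in _ - X]xy'; nra.
rewrite mulr1 gerDr subr_le0 ler_expR; lra.
Qed.

(** Convexity of the exponential, from its tangent at [- (theta * y)]. *)
Let g_star theta y : 0 <= theta <= 1 -> g (theta * y) <= theta * g y.
Proof.
move=> /andP[t0 t1]; rewrite /g.
set M := expR (- (theta * y)); have M0 : 0 < M := expR_gt0 _.
have h1 : M * (1 + (theta * y - y)) <= expR (- y).
  have -> : expR (- y) = M * expR (theta * y - y).
    by rewrite -expRD; congr expR; ring.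
  by rewrite ler_pM2l// expR_ge1Dx.
have h2 : M * (1 + theta * y) <= 1.
  rewrite -[leRHS](_ : M * expR (theta * y) = 1) ?ler_pM2l ?expR_ge1Dx//.
  by rewrite -expRD addNr expR0.
have h3 := ler_wpM2l t0 h1.
have h4 : (1 - theta) * (M * (1 + theta * y)) <= (1 - theta) * 1.
  by rewrite ler_wpM2l ?subr_ge0.
have eM : M = theta * (M * (1 + (theta * y - y))) +
    (1 - theta) * (M * (1 + theta * y)) by ring.
rewrite mulr1 in h4.
suff : M <= theta * expR (- y) + (1 - theta) by lra.
by rewrite [leLHS]eM lerD.
Qed.

(** The derivative of [g] on [[0, y]] is at most [min 1 y]; the factor
    [min u (u ^ 2)] is the function that the branching parameters make
    integrable. *)
Let kernel_dominated (u x y Z : R) : 0 < u -> 0 <= x -> x <= y -> y <= Z ->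
  1 <= Z ->
  0 <= g (u * y) - g (u * x) <= (y - x) * Z * Num.min u (u ^+ 2).
Proof.
move=> u0 x0 xy yZ Z1.
have /andP[-> /=] := @g_increment (u * x) (u * y) (mulr_ge0 (ltW u0) x0)
  (ler_wpM2l (ltW u0) xy).
move=> /le_trans; apply; rewrite -mulrBr.
rewrite -!mulrA [u * _]mulrC -mulrA ler_wpM2l ?subr_ge0//.
rewrite minr_pMl ?(ltW u0)// minr_pMr ?(le_trans ler01)//.
rewrite le_min !ge_min mul1r; apply/andP; split; apply/orP; [left|right].
  by rewrite ler_peMl// ltW.
rewrite mulrAC -expr2 mulrC.
by rewrite ler_wpM2r// sqr_ge0.
Qed.

Section parameters.
Context (b c : R) (m : {measure set R -> \bar R})
  (bcm : branching_parameters c m).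

Let k (u : R) := Num.min u (u ^+ 2).

Let integrable_k : m.-integrable `]0, +oo[ (EFin \o k).
Proof.
case: bcm => _ mk; apply/integrableP; split.
  by apply/measurable_EFinP; apply: measurable_minr.
apply: le_lt_trans mk; rewrite le_eqVlt; apply/orP; left; apply/eqP.
apply: eq_integral => u; rewrite inE/= in_itv/= andbT => u0.
by rewrite ger0_norm// /k le_min (ltW u0) sqr_ge0.
Qed.

Let integrable_kernel z : 0 <= z ->
  m.-integrable `]0, +oo[ (EFin \o (fun u => g (u * z))).
Proof.
move=> z0; pose Z := Num.max 1 z.
apply: (@le_integrable _ _ _ m _ _ _ (EFin \o (fun u => z * Z * k u))) => //.
- apply/measurable_EFinP; apply: measurable_funD; last exact: measurable_funM.
  apply: measurable_funB => //; apply: measurableT_comp => //.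
  by apply: measurableT_comp => //; exact: measurable_funM.
- move=> u /=; rewrite in_itv/= andbT => u0.
  have zZ : z <= Z by rewrite le_max lexx orbT.
  have Z1 : 1 <= Z by rewrite le_max lexx.
  have := @kernel_dominated u 0 z Z u0 (lexx _) z0 zZ Z1.
  have g0 : g 0 = 0 by rewrite /g oppr0 expR0 subrr addr0.
  rewrite mulr0 g0 !subr0 => /andP[h1 h2].
  by rewrite lee_fin ger0_norm// (le_trans h2)// ler_norm.
- exact: (integrableZl _ _ integrable_k).
Qed.

Lemma branching_mechanism_lipschitz Z : 1 <= Z ->
  exists L, forall x y, 0 <= x -> x <= y -> y <= Z ->
  `|branching_mechanism b c m y - branching_mechanism b c m x| <= L * (y - x).
Proof.
move=> Z1.
exists (`|b| + c * (2 * Z) + Z * \int[m]_(u in `]0, +oo[) k u) => x y x0 xy yZ.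
have y0 := le_trans x0 xy.
rewrite /branching_mechanism.
set I := fun z => \int[m]_(u in `]0, +oo[) (expR (- (u * z)) - 1 + u * z).
have -> : b * y + c * y ^+ 2 + I y - (b * x + c * x ^+ 2 + I x) =
  b * (y - x) + c * (y ^+ 2 - x ^+ 2) + (I y - I x) by ring.
have dI : `|I y - I x| <= Z * (\int[m]_(u in `]0, +oo[) k u) * (y - x).
  rewrite /I -RintegralB//; [|exact: integrable_kernel..].
  have ixy : m.-integrable `]0, +oo[
      (EFin \o (fun u => g (u * y) - g (u * x))).
    exact: (integrableB _ (integrable_kernel y0) (integrable_kernel x0)).
  rewrite [leRHS](_ : _ = \int[m]_(u in `]0, +oo[) ((y - x) * Z * k u)).
    apply: (le_trans (le_normr_Rintegral _ _)) => //.
    apply: le_Rintegral => //.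
    - exact: (integrable_abse ixy).
    - exact: (integrableZl _ _ integrable_k).
    - move=> u /=; rewrite in_itv/= andbT => u0.
      have /andP[h1 h2] := @kernel_dominated u x y Z u0 x0 xy yZ Z1.
      by rewrite ger0_norm.
  by rewrite RintegralZl//; ring.
rewrite (le_trans (ler_normD _ _))// !mulrDl lerD//.
rewrite (le_trans (ler_normD _ _))// lerD//.
  by rewrite normrM (ger0_norm (_ : 0 <= y - x)) ?subr_ge0.
have [c0 _] := bcm.
rewrite normrM ger0_norm// -mulrA ler_wpM2l// subr_sqr normrM mulrC.
rewrite ler_pM//; first by rewrite ger0_norm; lra.
by rewrite ger0_norm ?subr_ge0.
Qed.

(** For negative arguments the integral defining the branching mechanism may
    diverge, so continuity on the half-line is expressed through the retraction
    [Num.max 0], which keeps a function defined on the whole line. *)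
Lemma branching_mechanism_continuous :
  continuous (branching_mechanism b c m \o Num.max 0).
Proof.
move=> x; apply/cvgrPdist_lt => e e0.
pose Z := `|x| + 1.
have [|L hL] := @branching_mechanism_lipschitz Z; first by rewrite lerDr.
have max0 z : 0 <= Num.max 0 z by rewrite le_max lexx.
have maxZ z : `|x - z| < 1 -> Num.max 0 z <= Z.
  move=> xz; rewrite ge_max /Z addr_ge0//=.
  have := ler_norm x; move: xz; rewrite ltr_norml; lra.
have L1 : 0 < `|L| + 1 by rewrite ltr_wpDl.
have xZ : Num.max 0 x <= Z by rewrite maxZ// subrr normr0.
near=> z.
have xz1 : `|x - z| < 1.
  near: z; apply/nbhs_ballP; exists 1 => //= z; exact.
have xzL : `|x - z| < e / (`|L| + 1).
  near: z; apply/nbhs_ballP; exists (e / (`|L| + 1)) => /=; first exact: divr_gt0.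
  by move=> z; exact.
have lip : `|Num.max 0 x - Num.max 0 z| <= `|x - z|.
  have [h1|h1] := leP 0 x; have [h2|h2] := leP 0 z.
  - by [].
  - rewrite subr0 ger0_norm// ger0_norm; lra.
  - rewrite sub0r normrN ger0_norm// ler0_norm; lra.
  - by rewrite subrr normr0.
have key : `|branching_mechanism b c m (Num.max 0 x) -
    branching_mechanism b c m (Num.max 0 z)| <=
    (`|L| + 1) * `|Num.max 0 x - Num.max 0 z|.
  have L' : L <= `|L| + 1 by have := ler_norm L; lra.
  have [xz|/ltW zx] := leP (Num.max 0 x) (Num.max 0 z).
    rewrite distrC (distrC (Num.max 0 x)).
    rewrite (le_trans (hL _ _ (max0 _) xz (maxZ _ xz1)))//.
    by rewrite (ger0_norm (_ : 0 <= _ - _)) ?subr_ge0// ler_wpM2r// subr_ge0.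
  rewrite (le_trans (hL _ _ (max0 _) zx xZ))//.
  by rewrite (ger0_norm (_ : 0 <= _ - _)) ?subr_ge0// ler_wpM2r// subr_ge0.
rewrite /= (le_lt_trans key)// mulrC -ltr_pdivlMr//.
exact: le_lt_trans xzL.
Unshelve. all: by end_near. Qed.

Lemma branching_mechanism_star : star_shaped (branching_mechanism b c m).
Proof.
move=> theta z t01 z0; have /andP[t0 t1] := t01; have [c0 _] := bcm.
rewrite /branching_mechanism !mulrDr; apply: lerD; first apply: lerD.
- by rewrite mulrCA.
- rewrite exprMn mulrCA ler_wpM2r ?mulr_ge0 ?sqr_ge0//.
  by rewrite expr2 ler_piMl.
rewrite -RintegralZl//; last exact: integrable_kernel.
apply: le_Rintegral => //.
- by apply: integrable_kernel; rewrite mulr_ge0.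
- exact: (integrableZl _ _ (integrable_kernel z0)).
- by move=> u _; rewrite mulrCA; exact: g_star.
Qed.

End parameters.

End branching_mechanism.

(** * Grey's condition *)

Section grey.
Context {R : realType}.
Implicit Types (phi f : R -> R) (x y z A : R).
Notation mu := (@lebesgue_measure R).

Let sub_ocitv A x y : A <= x -> `]x, y]%classic `<=` `[A, +oo[%classic.
Proof.
move=> Ax z; rewrite /= !in_itv/= andbT => /andP[xz _].
by rewrite (le_trans Ax)// ltW.
Qed.

Let sub_coitv A x : A <= x -> `[x, +oo[%classic `<=` `[A, +oo[%classic.
Proof. by move=> Ax z; rewrite /= !in_itv/= !andbT; exact: le_trans. Qed.

(** The integrals of [f] over [(A, x]] are nondecreasing in [x] and bounded;
    [X] is a point where they are within [kappa] of their supremum. *)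
Lemma integrable_tail f A kappa : mu.-integrable `[A, +oo[ (EFin \o f) ->
  (forall x, A <= x -> 0 <= f x) -> 0 < kappa ->
  exists2 X, A <= X & forall y, X <= y ->
    \int[mu]_(s in `]X, y]) f s < kappa.
Proof.
move=> fi f0 k0; pose H x := \int[mu]_(s in `]A, x]) f s.
have fiA x y : A <= x -> mu.-integrable `]x, y] (EFin \o f).
  by move=> Ax; apply: integrableS fi => //; exact: sub_ocitv.
pose S := [set H x | x in `[A, +oo[].
have ubS : has_ubound S.
  exists (\int[mu]_(s in `[A, +oo[) f s) => _ [x /= + <-].
  rewrite in_itv/= andbT => Ax.
  apply: fine_le; [exact: integrable_fin_num (fiA _ _ (lexx _))|
                   exact: integrable_fin_num fi|].
  apply: ge0_subset_integral => //; first exact: measurable_int fi.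
    by move=> y; rewrite /= in_itv/= andbT lee_fin; exact: f0.
  exact: sub_ocitv.
have supS : has_sup S by split => //; exists (H A), A; rewrite //= in_itv/= lexx.
have [_ [X /= + <-] HX] := sup_adherent k0 supS.
rewrite in_itv/= andbT => AX; exists X => // y Xy.
have : H y <= sup S.
  by apply: ub_le_sup => //; exists y; rewrite //= in_itv/= andbT (le_trans AX).
rewrite /H (@integral_chasles _ f A X y)//; last exact: fiA.
by move: HX; rewrite /H; lra.
Qed.

Lemma star_shaped_lower phi z : star_shaped phi -> 1 <= z ->
  z * phi 1 <= phi z.
Proof.
move=> st z1; have z0 : 0 < z by exact: lt_le_trans z1.
have := @st z^-1 z; rewrite mulVf ?gt_eqF// invr_ge0 (ltW z0) invf_le1// z1.
by move=> /(_ isT isT); rewrite ler_pdivlMl.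
Qed.

(** [phi x / x] is nondecreasing, so [phi] stays positive once it is, and then
    increases. *)
Lemma star_shaped_homo phi A : star_shaped phi -> 0 <= A -> 0 < phi A ->
  forall x y, A <= x -> x <= y -> 0 < phi x <= phi y.
Proof.
move=> st A0 phiA.
have step x y : 0 <= x -> 0 < phi x -> x <= y -> phi x <= phi y.
  move=> x0 fx; rewrite le_eqVlt => /predU1P[<-//|xy].
  have y0 : 0 < y by exact: le_lt_trans xy.
  have xy01 : 0 <= x / y <= 1.
    by rewrite divr_ge0 ?(ltW y0)//= ler_pdivrMr// mul1r ltW.
  have := st (x / y) y xy01 (ltW y0); rewrite divfK ?gt_eqF// => h.
  have /andP[xy0 xy1] := xy01.
  have fy : 0 < phi y.
    have /(lt_le_trans fx) := h; rewrite pmulr_rgt0//.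
    rewrite lt_neqAle xy0 andbT eq_sym; apply/eqP => xy_0.
    by move: h; rewrite xy_0 mul0r leNgt fx.
  by rewrite (le_trans h)// ler_piMl// ltW.
move=> x y Ax xy.
have fx : 0 < phi x by rewrite (lt_le_trans phiA)// step.
by rewrite fx step// (le_trans A0).
Qed.

(** The harmonic function has mass [1 / (2 * K)] on every interval
    [(X, 2 * X]], which contradicts the vanishing of tails. *)
Lemma not_integrable_harmonic f K A : 0 < K -> 1 <= A ->
  mu.-integrable `[A, +oo[ (EFin \o f) ->
  (forall x, A <= x -> (K * x)^-1 <= f x) -> False.
Proof.
move=> K0 A1 fi fK.
have A0 x : A <= x -> 0 < x by move=> Ax; rewrite (lt_le_trans ltr01)// (le_trans A1).
have f0 x : A <= x -> 0 <= f x.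
  by move=> Ax; rewrite (le_trans _ (fK x Ax))// invr_ge0 mulr_ge0 ?ltW// A0.
have kpos : 0 < (2 * K)^-1 by rewrite invr_gt0 mulr_gt0.
have [X AX tail] := integrable_tail fi f0 kpos.
have X0 := A0 X AX.
have X2X : X <= 2 * X by lra.
have := tail (2 * X) X2X; rewrite ltNge => /negP; apply.
have -> : (2 * K)^-1 = (K * (2 * X))^-1 * (2 * X - X).
  by field; rewrite !gt_eqF.
apply: integral_itv_ge => //.
  by apply: integrableS fi => //; exact: sub_ocitv.
move=> s /andP[Xs s2]; have As : A <= s by rewrite (le_trans AX)// ltW.
have s0 := A0 s As.
rewrite (le_trans _ (fK s As))// lef_pV2 ?posrE ?mulr_gt0//.
by rewrite ler_wpM2l// ltW.
Qed.

(** If [phi] were nonpositive on all of [[1, +oo)], star-shapedness would give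
    [|phi x| <= K * x] and [1 / |phi|] would not be integrable. Past a point
    where [phi] is positive, the extended inverse in Grey's condition is the
    real one. *)
Lemma grey_positive phi : star_shaped phi -> grey_condition phi ->
  exists A, [/\ 0 <= A, (forall x y, A <= x -> x <= y -> 0 < phi x <= phi y) &
    mu.-integrable `[A, +oo[ (EFin \o (fun z => (phi z)^-1))].
Proof.
move=> st gr.
have [A A1 phiA] : exists2 A, 1 <= A & 0 < phi A.
  apply: contrapT => nA.
  have phi0 x : 1 <= x -> phi x <= 0.
    by move=> x1; rewrite leNgt; apply/negP => fx; apply: nA; exists x.
  pose K := 1 - phi 1; have K0 : 0 < K by have := phi0 1 (lexx _); rewrite /K; lra.
  apply: (@not_integrable_harmonic (fun x => (K * x)^-1) K 1) => //.
  apply: le_integrable gr => //.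
    apply/measurable_EFinP; apply: subspace_continuous_measurable_fun => //.
    apply/subspace_continuousP => x /=; rewrite in_itv/= andbT => x1.
    apply: cvg_within_filter; apply: (@cvgV _ _ _ _ (fun x => K * x)).
      by rewrite mulf_neq0// gt_eqF// (lt_le_trans ltr01).
    exact: cvgMr.
  move=> x /=; rewrite in_itv/= andbT => x1.
  have x0 : 0 < x by exact: lt_le_trans x1.
  rewrite inver; case: eqP => [_|/eqP fx]; first by rewrite leey.
  rewrite lee_fin normfV [leRHS]normfV lef_pV2 ?posrE ?normr_gt0//; last first.
    by rewrite mulf_neq0// gt_eqF.
  rewrite (ler0_norm (phi0 _ x1)) (gtr0_norm (mulr_gt0 K0 x0)).
  have := star_shaped_lower st x1; rewrite /K; nra.
have A0 : 0 <= A by rewrite (le_trans ler01).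
have hom := star_shaped_homo st A0 phiA.
exists A; split => //.
have iA : mu.-integrable `[A, +oo[ (fun z => ((phi z)%:E^-1)%E).
  by apply: integrableS gr => //; exact: sub_coitv.
apply: eq_integrable iA => // z; rewrite inE/= in_itv/= andbT => Az.
by rewrite inver gt_eqF//; have /andP[] := hom z z Az (lexx _).
Qed.

End grey.

(** * Cadlag paths *)

Section cadlag.
Context {R : realType}.
Implicit Types (f : R -> R) (t : R).

Lemma cadlag_bounded f t : 0 <= t -> cadlag f ->
  exists M, forall s, 0 <= s <= t -> `|f s| <= M.
Proof.
move=> t0 [fr fl]; apply: bounded_of_locally_bounded => // p /andP[p0 pt].
have near_le l q : `|l - f q| < 1 -> `|f q| <= `|l| + 1.
  move=> lq; rewrite -[f q](subKr l) (le_trans (ler_normB _ _))//.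
  by rewrite lerD2l ltW.
have /cvgrPdist_lt/(_ 1 ltr01)/nbhs_ballP[d1 /= d10 hd1] := fr p p0.
have [l [d2 d20 hd2]] : exists l, exists2 d, 0 < d & forall q, 0 <= q -> q < p ->
    `|q - p| < d -> `|l - f q| < 1.
  have [p_gt0|p_le0] := ltP 0 p; last first.
    by exists 0, 1 => // q q0 qp; have := lt_le_trans qp p_le0; rewrite ltNge q0.
  have [l /cvgrPdist_lt/(_ 1 ltr01)/nbhs_ballP[d /= d0 hd]] := fl p p_gt0.
  exists l, d => // q _ qp qpd; apply: hd => //.
  by rewrite /ball/= distrC.
exists (Num.min d1 d2); first by rewrite lt_min d10.
exists (Num.max (`|f p| + 1) (`|l| + 1)) => q /andP[q0 _].
rewrite lt_min => /andP[qd1 qd2]; rewrite le_max; apply/orP.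
have [qp|pq|->] := ltgtP q p.
- by right; apply: near_le; exact: hd2.
- by left; apply: near_le; apply: hd1 => //; rewrite /ball/= distrC.
- by left; rewrite lerDl.
Qed.

(** By right continuity the path is the pointwise limit of its values at the
    next point of the grid of mesh [1 / (n + 1)], which are step functions.
    The next grid point is taken strictly to the right, as the path need not be
    left continuous. *)
Lemma cadlag_measurable f : cadlag f ->
  measurable_fun (`[0, +oo[%classic : set R) f.
Proof.
move=> [fr _].
pose up (n : nat) (s : R) : R := (Num.truncn (n.+1%:R * s)).+1%:R / n.+1%:R.
have n0 (n : nat) : 0 < n.+1%:R :> R by rewrite ltr0n.
have upP n s : 0 <= s -> s < up n s <= s + n.+1%:R^-1.
  move=> s0; have /truncn_itv/andP[h1 h2] : 0 <= n.+1%:R * s by rewrite mulr_ge0.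
  rewrite /up ltr_pdivlMr// mulrC h2/= ler_pdivrMr// mulrDl mulVf ?gt_eqF//.
  by rewrite -natr1 lerD2r [s * _]mulrC.
apply: (@measurable_fun_cvg _ _ _ _ (fun n s => f (up n s))); last first.
  move=> s /=; rewrite in_itv/= andbT => s0.
  apply/cvgrPdist_lt => e e0.
  have /cvgrPdist_lt/(_ e e0)/nbhs_ballP[d /= d0 hd] := fr s s0.
  near=> n; have /andP[su us] := upP n s s0.
  apply: hd => //; rewrite /ball/= distrC gtr0_norm ?subr_gt0//.
  rewrite ltrBlDl (le_lt_trans us)// ltrD2l.
  by near: n; exact: (near_infty_natSinv_lt (PosNum d0)).
move=> n; pose piece (k : nat) := `[k%:R / n.+1%:R, k.+1%:R / n.+1%:R[%classic : set R.
have -> : `[0, +oo[%classic = \bigcup_k piece k.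
  apply/seteqP; split => s.
    rewrite /= in_itv/= andbT => s0; exists (Num.truncn (n.+1%:R * s)) => //=.
    have /truncn_itv/andP[h1 h2] : 0 <= n.+1%:R * s by rewrite mulr_ge0.
    by rewrite /piece /= in_itv/= ltr_pdivlMr// ler_pdivrMr// [s * _]mulrC h1.
  move=> [k _]; rewrite /piece /= !in_itv/= andbT => /andP[ks _].
  by rewrite (le_trans _ ks)// divr_ge0.
apply/measurable_fun_bigcup => [k|k]; first exact: measurable_itv.
apply: (@eq_measurable_fun _ _ _ _ _ (cst (f (k.+1%:R / n.+1%:R)))) => //.
move=> s; rewrite inE /piece/= in_itv/= => /andP[h1 h2]; rewrite /up.
rewrite (@truncn_def _ _ k)// [_ * s]mulrC -ler_pdivrMr// h1/=.
by rewrite -ltr_pdivlMr.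
Unshelve. all: by end_near. Qed.

End cadlag.

(** * The drift in a given environment *)

Section drift.
Context {R : realType} (phi xi : R -> R).
Implicit Types (u w : R -> R) (r s t q K B C v : R).
Notation mu := (@lebesgue_measure R).
Notation drift := (environment_drift phi xi).

Lemma drift_bounded t K B : continuous (phi \o Num.max 0) -> 0 <= B ->
  (forall r, 0 <= r <= t -> `|xi r| <= K) ->
  exists C, forall s v, 0 <= s <= t -> 0 <= v <= B -> `|drift s v| <= C.
Proof.
move=> cphi B0 xiK.
have KB : 0 <= expR K * B by rewrite mulr_ge0 ?expR_ge0.
have cn : continuous (fun z => `|(phi \o Num.max 0) z|).
  by move=> z; apply: cvg_norm; exact: cphi.
have [c _ hc] := EVT_max KB (continuous_subspaceT cn).
exists (expR K * `|(phi \o Num.max 0) c|) => s v /xiK + /andP[v0 vB].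
rewrite ler_norml => /andP[xK1 xK2].
rewrite normrM ger0_norm ?expR_ge0// ler_pM ?expR_ge0 ?ler_expR//.
have z0 : 0 <= expR (- xi s) * v by rewrite mulr_ge0 ?expR_ge0.
have := hc (expR (- xi s) * v); rewrite in_itv/= z0 max_r//; apply.
by rewrite ler_pM ?expR_ge0// ler_expR lerNl.
Qed.

(** Measurability of the drift of an arbitrary continuous path; for the
    solutions of the backward equation it is part of integrability. *)
Lemma drift_measurable s w : continuous (phi \o Num.max 0) -> cadlag xi ->
  measurable_fun (`]0, s]%classic : set R) w ->
  (forall r, 0 < r <= s -> 0 <= w r) ->
  measurable_fun (`]0, s]%classic : set R) (fun r => drift r (w r)).
Proof.
move=> cphi cxi mw w0.
have mxi : measurable_fun (`]0, s]%classic : set R) xi.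
  apply: measurable_funS (cadlag_measurable cxi) => // r.
  by rewrite /= !in_itv/= andbT => /andP[/ltW].
apply: (@eq_measurable_fun _ _ _ _ _ (fun r =>
    expR (xi r) * (phi \o Num.max 0) (expR (- xi r) * w r))).
  move=> r; rewrite inE/= in_itv/= => rs.
  by rewrite max_r// mulr_ge0 ?expR_ge0 ?w0.
apply: measurable_funM; first exact: measurableT_comp.
apply: measurableT_comp; first exact: continuous_measurable_fun.
apply: measurable_funM => //; apply: measurableT_comp => //.
exact: measurableT_comp.
Qed.

Lemma drift_cvg s (v_ : nat -> R) v : continuous (phi \o Num.max 0) ->
  (forall n, 0 <= v_ n) -> 0 <= v -> v_ n @[n --> \oo] --> v ->
  drift s (v_ n) @[n --> \oo] --> drift s v.
Proof.
move=> cphi vn0 v0 vv; rewrite /environment_drift; apply: cvgMr.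
have e0 := expR_ge0 (- xi s).
have phiE z : 0 <= z -> phi z = (phi \o Num.max 0) z.
  by move=> z0; rewrite /= max_r.
rewrite phiE ?mulr_ge0//.
under eq_fun do rewrite phiE ?mulr_ge0//.
have ev : expR (- xi s) * v_ n @[n --> \oo] --> expR (- xi s) * v.
  exact: cvgMr.
exact: (cvg_comp _ _ ev (cphi _)).
Qed.

End drift.

(** * The integral equation and comparison *)

Section backward_equation.
Context {R : realType} (phi xi : R -> R).
Implicit Types (u v w : R -> R) (r s t q lambda : R).
Notation mu := (@lebesgue_measure R).
Notation drift := (environment_drift phi xi).

(** The backward equation on [[0, q]] in incremental form, with the terminal
    value left free: this form restricts to shorter intervals and is stable
    under gluing. *)
Definition integral_solution q w :=
  [/\ forall r, 0 <= r <= q -> 0 <= w r,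
      mu.-integrable `]0, q] (fun s => (drift s (w s))%:E) &
      forall x y, 0 <= x -> x <= y -> y <= q ->
        w y - w x = \int[mu]_(s in `]x, y]) drift s (w s)].

Lemma backward_solutionP t lambda u : 0 <= t ->
  positive_backward_solution phi xi t lambda u <->
  integral_solution t u /\ u t = lambda.
Proof.
move=> t0; split=> [[u0 ui ueq]|[[u0 ui uinc] <-]].
  have ut : u t = lambda.
    by rewrite ueq ?in_itv/= ?t0 ?lexx// set_itv_ge ?bnd_simp ?ltxx//
      Rintegral_set0 subr0.
  split => //; split => // x y x0 xy yt.
  rewrite [u y]ueq ?in_itv/= ?yt ?andbT ?(le_trans x0)//.
  rewrite [u x]ueq ?in_itv/= ?x0 ?(le_trans xy)//.
  rewrite (@integral_chasles _ (fun s => drift s (u s)) x y t)//; last first.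
    exact: integrable_subitv ui.
  by ring.
split => // r; rewrite in_itv/= => /andP[r0 rt].
by rewrite -uinc//; ring.
Qed.

Lemma integral_solution_le q t w : q <= t -> integral_solution t w ->
  integral_solution q w.
Proof.
move=> qt [w0 wi winc]; split.
- by move=> r /andP[r0 rq]; rewrite w0// r0 (le_trans rq).
- exact: integrable_subitv wi.
- by move=> x y x0 xy yq; apply: winc => //; exact: le_trans qt.
Qed.

Lemma integral_solution_continuous q w : integral_solution q w ->
  {within `[0, q], continuous w}.
Proof. by move=> [_ wi winc]; exact: integral_increments_continuous winc. Qed.

Lemma integral_solution_glue q t u w : 0 <= q -> q <= t ->
  integral_solution t u -> integral_solution q w -> w q = u q ->
  integral_solution t (fun r => if r <= q then w r else u r).
Proof.
move=> q0 qt [u0 ui uinc] [w0 wi winc] wuq.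
set v := fun r => if r <= q then w r else u r.
have vw x y : y <= q ->
    {in `]x, y]%classic, forall s, drift s (v s) = drift s (w s)}.
  move=> yq s; rewrite inE/= in_itv/= => /andP[_ sy].
  by rewrite /v (le_trans sy yq).
have vu x y : q <= x ->
    {in `]x, y]%classic, forall s, drift s (v s) = drift s (u s)}.
  move=> qx s; rewrite inE/= in_itv/= => /andP[xs _].
  by rewrite /v leNgt (le_lt_trans qx xs).
have ivw x y : y <= q ->
    \int[mu]_(s in `]x, y]) drift s (v s) = \int[mu]_(s in `]x, y]) drift s (w s).
  by move=> yq; apply: eq_Rintegral; exact: vw.
have ivu x y : q <= x ->
    \int[mu]_(s in `]x, y]) drift s (v s) = \int[mu]_(s in `]x, y]) drift s (u s).
  by move=> qx; apply: eq_Rintegral; exact: vu.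
have vuq r : q <= r -> v r = u r.
  move=> qr; rewrite /v; case: ifP => // rq.
  by have -> : r = q by apply/le_anti; rewrite rq.
have viq : mu.-integrable `]0, q] (fun s => (drift s (v s))%:E).
  apply: eq_integrable wi => // s sq; congr EFin.
  by rewrite (vw 0 q).
have viqt : mu.-integrable `]q, t] (fun s => (drift s (v s))%:E).
  apply: eq_integrable (integrable_subitv q0 (lexx t) ui) => // s sq.
  by congr EFin; rewrite (vu q t).
have vi : mu.-integrable `]0, t] (fun s => (drift s (v s))%:E).
  exact: (@integrable_itv_cat _ (fun s => drift s (v s)) _ q).
split => //.
  move=> r /andP[r0 rt]; rewrite /v; case: ifP => rq.
    by rewrite w0// r0.
  by rewrite u0// r0.
move=> x y x0 xy yt.
have [yq|/ltW qy] := leP y q.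
  rewrite ivw// -winc//.
  by rewrite /v yq (le_trans xy yq).
have [qx|/ltW xq] := leP q x.
  by rewrite ivu// -uinc// !vuq// (le_trans qx).
rewrite (@integral_chasles _ (fun s => drift s (v s)) x q y)//; last first.
  exact: integrable_subitv vi.
rewrite ivw// ivu// -winc// -uinc// wuq vuq// [v x]/v xq; ring.
Qed.

(** If [w r < u r], continuity provides a time [c] between [r] and [q] where
    [u] and [w] agree. The path equal to [w] up to [c] and to [u] afterwards
    solves the equation with the terminal value of [u], so uniqueness forces
    [w r = u r]. *)
Lemma unique_solution_comparison q t lambda u w : 0 <= q -> q <= t ->
  unique_positive_backward_solution phi xi t lambda u ->
  integral_solution q w -> u q <= w q ->
  forall r, 0 <= r <= q -> u r <= w r.
Proof.
move=> q0 qt [/backward_solutionP su uniq] sw uwq r /andP[r0 rq].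
have t0 := le_trans q0 qt.
have [{}su ut] := su t0.
rewrite leNgt; apply/negP => wu.
have cuw : {within `[r, q], continuous (fun x => w x - u x)}.
  apply: (@continuous_subspaceW _ _ _ `[0, q]%classic).
    by move=> x /=; rewrite !in_itv/= => /andP[rx ->]; rewrite (le_trans r0).
  apply: within_continuousB; first exact: integral_solution_continuous.
  exact/integral_solution_continuous/(integral_solution_le qt).
have [c + /eqP] := IVT rq cuw (v := 0) ltac:(
  by rewrite ge_min subr_le0 (ltW wu) le_max !subr_ge0 uwq orbT).
rewrite in_itv/= subr_eq0 => /andP[rc cq] /eqP wc.
have c0 := le_trans r0 rc; have ct := le_trans cq qt.
pose v x := if x <= c then w x else u x.
have sv : positive_backward_solution phi xi t lambda v.
  apply/backward_solutionP => //; split.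
    by apply: integral_solution_glue => //; exact: integral_solution_le sw.
  rewrite /v; case: ifP => // tc.
  by rewrite -ut (_ : t = c)//; apply/le_anti; rewrite tc.
have := uniq v sv r; rewrite in_itv/= r0 (le_trans rc ct) => /(_ isT).
by rewrite /v rc => wur; move: wu; rewrite wur ltxx.
Qed.

End backward_equation.

(** * A bound uniform in the terminal value *)

Section a_priori_bound.
Context {R : realType} (phi xi : R -> R).
Implicit Types (u w : R -> R) (r s t q K A v : R).
Notation mu := (@lebesgue_measure R).
Notation drift := (environment_drift phi xi).

(** The drift [y * phi (v / y)], with [y = exp (xi s)], is the perspective of
    [phi]; it is nonincreasing in [y] because [phi] is star-shaped. *)
Lemma drift_ge K s v : star_shaped phi -> `|xi s| <= K -> 0 <= v ->
  expR K * phi (v / expR K) <= drift s v.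
Proof.
move=> st; rewrite ler_norml => /andP[_ xK] v0.
pose theta := expR (xi s - K).
have t01 : 0 <= theta <= 1.
  by rewrite expR_ge0/= -expR0 ler_expR subr_le0.
have z0 : 0 <= expR (- xi s) * v by rewrite mulr_ge0 ?expR_ge0.
have -> : v / expR K = theta * (expR (- xi s) * v).
  rewrite mulrA -expRD (_ : xi s - K - xi s = - K); last by ring.
  by rewrite expRN mulrC.
rewrite /environment_drift (_ : expR (xi s) = expR K * theta); last first.
  by rewrite -expRD; congr expR; ring.
by rewrite -mulrA ler_pM2l ?expR_gt0// st.
Qed.

(** The scaled solution [x = u / exp K] satisfies [x' >= phi x]. If it exceeds
    [X >= A] at time [r], it cannot come back to [A], hence increases, and
    separating variables gives
    [(t - r) / 2 <= \int_(x r)^(x t) dz / phi z]. Grey's condition makes the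
    right-hand side smaller than [(t - s) / 2] for [X] large, whatever the
    value of [x] at time [t]. *)
Lemma integral_solution_bound A K s t : star_shaped phi ->
  continuous (phi \o Num.max 0) -> 0 <= A ->
  (forall x y, A <= x -> x <= y -> 0 < phi x <= phi y) ->
  mu.-integrable `[A, +oo[ (EFin \o (fun z => (phi z)^-1)) ->
  (forall r, 0 <= r <= t -> `|xi r| <= K) -> s < t ->
  exists B, forall u, integral_solution phi xi t u ->
    forall r, 0 <= r <= s -> u r <= B.
Proof.
move=> st cphi A0 hom iphi xiK lst.
have phi_gt0 x : A <= x -> 0 < phi x.
  by move=> Ax; have /andP[] := hom x x Ax (lexx _).
have phi_homo x y : A <= x -> x <= y -> phi x <= phi y.
  by move=> Ax xy; have /andP[] := hom x y Ax xy.
have iphi_itv x y : A <= x ->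
    mu.-integrable `]x, y] (EFin \o (fun z => (phi z)^-1)).
  move=> Ax; apply: integrableS iphi => // z.
  rewrite /= !in_itv/= andbT => /andP[xz _].
  by rewrite (le_trans Ax)// ltW.
have iphi_ge x y : A <= x -> x <= y ->
    (y - x) / phi y <= \int[mu]_(z in `]x, y]) (phi z)^-1.
  move=> Ax xy; rewrite mulrC; apply: integral_itv_ge => //.
    exact: iphi_itv.
  move=> z /andP[/ltW xz zy]; have Az := le_trans Ax xz.
  by rewrite lef_pV2 ?posrE ?phi_gt0 ?phi_homo// (le_trans Az).
have d0 : 0 < (t - s) / 2 by rewrite divr_gt0// subr_gt0.
have iphi0 x : A <= x -> 0 <= (phi x)^-1.
  by move=> Ax; rewrite invr_ge0 ltW// phi_gt0.
have [X AX tail] := integrable_tail iphi iphi0 d0.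
pose M := expR K; have M0 : 0 < M := expR_gt0 K.
exists (M * X) => u su r /andP[r0 rs]; have [u0 ui uinc] := su.
rewrite leNgt; apply/negP => Xu.
have rt : r <= t by rewrite (le_trans rs)// ltW.
pose x p := u p / M.
have Xx : X < x r by rewrite ltr_pdivlMr// mulrC.
have cx : {within `[r, t], continuous x}.
  have cu : {within `[r, t], continuous u}.
    apply: continuous_subspaceW (integral_solution_continuous su).
    by move=> p; rewrite /= !in_itv/= => /andP[rp ->]; rewrite (le_trans r0).
  by move=> p; apply: cvgMl; exact: cu.
have drift_x p : r <= p <= t -> M * phi (x p) <= drift p (u p).
  move=> /andP[rp pt]; apply: drift_ge => //.
    by apply: xiK; rewrite (le_trans r0).
  by apply: u0; rewrite (le_trans r0).
have xinc p q e : r <= p -> p <= q -> q <= t ->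
    (forall z, p < z <= q -> e <= phi (x z)) -> e * (q - p) <= x q - x p.
  move=> rp pq qt ez; rewrite /x -mulrBl uinc ?(le_trans r0)//.
  rewrite ler_pdivlMr// mulrC mulrA; apply: integral_itv_ge => //.
    by apply: integrable_subitv ui => //; rewrite (le_trans r0).
  move=> z /andP[pz zq]; apply: le_trans (drift_x z _).
    by rewrite ler_pM2l// ez// pz.
  by rewrite (le_trans rp (ltW pz)) (le_trans zq).
(* The first time at which x would equal A is reached by increasing from a
   value above A. *)
have xA p : r <= p <= t -> A < x p.
  move=> /andP[rp pt]; rewrite ltNge; apply/negP => xpA.
  have cxA : {within `[r, p], continuous (fun z => x z - A)}.
    apply: (@continuous_subspaceW _ _ _ `[r, t]%classic).
      by move=> z; rewrite /= !in_itv/= => /andP[-> zp]; rewrite (le_trans zp).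
    by apply: within_continuousB => // z; exact: cvg_cst.
  have [||c [/andP[rc cp] xc xpos]] := first_exit rp cxA.
  - by rewrite subr_gt0 (le_lt_trans AX).
  - by rewrite subr_le0.
  have := @xinc r c 0 (lexx _) rc (le_trans cp pt).
  rewrite mul0r; have -> : x c = A by apply/eqP; rewrite -subr_eq0 xc.
  have xrA : A < x r by rewrite (le_lt_trans AX).
  have Az z : r < z <= c -> A <= x z.
    move=> /andP[rz]; rewrite le_eqVlt => /predU1P[->|zc].
      by rewrite -subr_ge0 xc.
    by rewrite -subr_ge0 ltW// xpos// (ltW rz).
  move=> h; have {}h : 0 <= A - x r by apply: h => z /Az /phi_gt0 /ltW.
  by move: h; rewrite subr_ge0 leNgt xrA.
have x_homo p q : r <= p -> p <= q -> q <= t -> x p <= x q.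
  move=> rp pq qt; rewrite -subr_ge0.
  rewrite -[leLHS](mul0r (q - p)); apply: xinc => // z /andP[pz zq].
  by rewrite ltW// phi_gt0// ltW// xA// (le_trans rp (ltW pz)) (le_trans zq).
have x_ge p q : r <= p -> p <= q -> q <= t ->
    phi (x p) * (q - p) <= x q - x p.
  move=> rp pq qt; apply: xinc => // z /andP[pz zq].
  have pt := le_trans pq qt.
  by rewrite phi_homo// ?x_homo ?(ltW pz) ?(le_trans zq)// ltW// xA// rp.
have int_x p q : r <= p -> p <= q -> q <= t ->
    phi (x p) / phi (x q) * (q - p) <= \int[mu]_(z in `]x p, x q]) (phi z)^-1.
  move=> rp pq qt; have pt := le_trans pq qt; have rq := le_trans rp pq.
  have Axp : A < x p by rewrite xA// rp.
  have Axq : A < x q by rewrite xA// rq.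
  apply: le_trans (iphi_ge _ _ (ltW Axp) (x_homo p q rp pq qt)).
  by rewrite mulrAC ler_pM2r ?invr_gt0 ?phi_gt0 ?(ltW Axq)// x_ge.
(* The ratio phi (x p) / phi (x q) in int_x is close to 1 for p close to q by
   continuity, on both sides of a given point; any factor below 1, here 1/2,
   survives the chaining. *)
have total : (t - r) / 2 <= \int[mu]_(z in `]x r, x t]) (phi z)^-1.
  pose P p q := (q - p) / 2 <= \int[mu]_(z in `]x p, x q]) (phi z)^-1.
  apply: (@interval_chaining _ P r t rt).
    move=> p q z rp pq qz zt Ppq Pqz; rewrite /P.
    have qt := le_trans qz zt; have pt := le_trans pq qt.
    rewrite (@integral_chasles _ _ _ (x q)).
    - by move: Ppq Pqz; rewrite /P; lra.
    - exact: x_homo.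
    - by apply: x_homo => //; exact: le_trans pq.
    - by apply: iphi_itv; rewrite ltW// xA// rp.
  move=> p /andP[rp pt].
  have Axp : A < x p by rewrite xA// rp.
  have fp := phi_gt0 _ (ltW Axp).
  have phiM z : A < z -> phi (Num.max 0 z) = phi z.
    by move=> Az; rewrite max_r// (le_trans A0)// ltW.
  have e0 : 0 < phi (x p) / 3 by rewrite divr_gt0.
  have /cvgrPdist_lt/(_ _ e0)/nbhs_ballP[d1 /= d10 hd1] := cphi (x p).
  have rtp : `[r, t]%classic p by rewrite /= in_itv/= rp.
  have [d d_gt0 hd] := (within_continuous_distP _ _).1 cx p rtp d1 d10.
  exists d => // q /andP[rq qt] qpd.
  have Axq : A < x q by rewrite xA// rq.
  have rtq : `[r, t]%classic q by rewrite /= in_itv/= rq.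
  have := hd1 (x q); rewrite /ball/= distrC => /(_ (hd q rtq qpd)).
  rewrite !phiM//.
  rewrite ltr_norml => /andP[l1 l2].
  have fq := phi_gt0 _ (ltW Axq).
  split => [qp|pq]; rewrite /P.
  - apply: le_trans (int_x q p rq qp pt).
    rewrite mulrC ler_wpM2r ?subr_ge0// ler_pdivlMr//; lra.
  - apply: le_trans (int_x p q rp pq qt).
    rewrite mulrC ler_wpM2r ?subr_ge0// ler_pdivlMr//; lra.
have xrt : x r <= x t by apply: x_homo.
have := tail (x t) (le_trans (ltW Xx) xrt).
rewrite (@integral_chasles _ _ X (x r)) ?(ltW Xx)//; last exact: iphi_itv.
have : 0 <= \int[mu]_(z in `]X, x r]) (phi z)^-1.
  apply: Rintegral_ge0 => z; rewrite /= in_itv/= => /andP[Xz _].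
  by apply: iphi0; rewrite (le_trans AX)// ltW.
by move: total rs; lra.
Qed.

End a_priori_bound.

(** * Explosive solutions *)

Section explosive_solutions.
Context {R : realType} (phi xi : R -> R).
Implicit Types (w : R -> R) (s t : R).
Notation mu := (@lebesgue_measure R).
Notation drift := (environment_drift phi xi).

(** On [[0, s]] both [w] and the environment are bounded, so the drift is
    bounded and its integral is Lipschitz. The difference of [w] and this
    integral is absolutely continuous with almost everywhere null derivative,
    hence constant. *)
Lemma explosive_integral_solution s t w : continuous (phi \o Num.max 0) ->
  cadlag xi -> 0 <= s -> s < t ->
  explosive_solution phi xi t w -> integral_solution phi xi s w.
Proof.
move=> cphi cxi s0 st [w0 cw acw dw _].
have t0 : 0 <= t by rewrite (le_trans s0)// ltW.
have w0s r : 0 <= r <= s -> 0 <= w r.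
  by move=> /andP[r0 rs]; rewrite w0// in_itv/= r0 (le_lt_trans rs).
have cws : {within `[0, s], continuous w}.
  apply: continuous_subspaceW cw => r.
  by rewrite /= !in_itv/= => /andP[-> rs]; rewrite (le_lt_trans rs).
have [c cs hc] := EVT_max s0 cws.
have wc0 : 0 <= w c by apply: w0s; move: cs; rewrite in_itv.
have [K hK] := cadlag_bounded s0 cxi.
have [C hC] := drift_bounded cphi wc0 hK.
have dC r : 0 < r <= s -> `|drift r (w r)| <= C.
  move=> /andP[r0 rs]; apply: hC; rewrite ?rs ?(ltW r0)//.
  by rewrite w0s ?hc ?in_itv/= ?rs ?(ltW r0).
have wi : mu.-integrable `]0, s] (EFin \o (fun r => drift r (w r))).
  apply: integrable_bounded_itv dC.
  apply: drift_measurable => //; last first.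
    by move=> r /andP[r0 rs]; rewrite w0s// rs ltW.
  have mw := subspace_continuous_measurable_fun (measurable_itv `[0, s]) cws.
  apply: measurable_funS mw => // r.
  by rewrite /= !in_itv/= => /andP[/ltW -> ->].
split => // x y x0 xy ys.
have wxy := integrable_subitv x0 ys wi.
pose I r := \int[mu]_(z in `]x, r]) drift z (w z).
have Iinc p q : x <= p -> p <= q -> q <= y ->
    I q - I p = \int[mu]_(z in `]p, q]) drift z (w z).
  move=> xp pq qy; rewrite /I (@integral_chasles _ _ x p q)//.
    by rewrite addrC addKr.
  exact: integrable_subitv wxy.
have Ixx : I x = 0 by rewrite /I set_itv_ge ?Rintegral_set0// bnd_simp ltxx.
have : w y - I y = w x - I x; last by rewrite Ixx -/(I y); lra.
apply: (@absolutely_continuous_derive0 _ x y (fun r => w r - I r) xy).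
- apply: absolutely_continuousB.
    apply: absolutely_continuousS x0 ys _; apply: acw.
    by rewrite in_itv/= s0.
  apply: (@lipschitz_absolutely_continuous _ _ _ _ C) => p q xp pq qy.
  rewrite Iinc//; apply: integral_itv_norm_le => //.
    exact: integrable_subitv wxy.
  move=> r /andP[pr rq]; apply: dC.
  by rewrite (le_lt_trans (le_trans x0 xp) pr) (le_trans rq (le_trans qy ys)).
- have := integral_increments_derive wxy Iinc; move: dw.
  apply: filterS2; first exact: (ae_filter_ringOfSetsType mu).
  move=> r dwr dIr rxy.
  rewrite -(subrr (drift r (w r))); apply: is_deriveB; last exact: dIr.
  apply: dwr; move: rxy; rewrite !in_itv/= => /andP[xr ry].
  by rewrite (le_lt_trans x0 xr) (lt_trans (lt_le_trans ry ys)).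
Qed.

End explosive_solutions.

(** * The flow at infinity *)

Section flow_at_infinity.
Context {R : realType} (phi xi : R -> R) (u : R -> R -> R -> R)
  (cphi : continuous (phi \o Num.max 0)) (cxi : cadlag xi)
  (uniq : forall t lambda, 0 <= t -> 0 <= lambda ->
    unique_positive_backward_solution phi xi t lambda (fun r => u r t lambda)).
Implicit Types (w : R -> R) (r s t q lambda : R).
Notation mu := (@lebesgue_measure R).
Notation drift := (environment_drift phi xi).

Lemma flow_solution t lambda : 0 <= t -> 0 <= lambda ->
  integral_solution phi xi t (fun r => u r t lambda) /\ u t t lambda = lambda.
Proof. by move=> t0 l0; have [/backward_solutionP su _] := uniq t0 l0; exact: su. Qed.

(** Comparison on the whole interval [[0, t]], where the terminal values are
    ordered by assumption. *)
Lemma flow_homo t lambda1 lambda2 r : 0 <= lambda1 -> lambda1 <= lambda2 ->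
  0 <= r <= t -> u r t lambda1 <= u r t lambda2.
Proof.
move=> l10 l12 rt; have t0 : 0 <= t by have /andP[/le_trans] := rt; apply.
have [_ u1] := flow_solution t0 l10.
have [su2 u2] := flow_solution t0 (le_trans l10 l12).
apply: (unique_solution_comparison t0 (lexx t) (uniq t0 l10) su2) => //.
by rewrite u1 u2.
Qed.

Definition limit_flow t r := sup [set u r t lambda | lambda in `[0, +oo[].

Context (t : R) (t0 : 0 < t)
  (bounded : forall s, s < t -> exists B, forall lambda r,
    0 <= lambda -> 0 <= r <= s -> u r t lambda <= B).

Let U := limit_flow t.

Let ubound_flow r : 0 <= r < t ->
  has_ubound [set u r t lambda | lambda in `[0, +oo[].
Proof.
move=> /andP[r0 rt]; have [B hB] := bounded rt.
exists B => _ [l /= + <-]; rewrite in_itv/= andbT => l0.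
by apply: hB => //; rewrite r0 lexx.
Qed.

Lemma flow_cvg r : 0 <= r < t -> u r t lambda @[lambda --> +oo] --> U r.
Proof.
move=> rt; apply: nondecreasing_cvg_sup; last exact: ubound_flow.
move=> x y x0 xy; apply: flow_homo => //.
by have /andP[-> /ltW] := rt.
Qed.

Lemma flow_le_limit r lambda : 0 <= lambda -> 0 <= r < t ->
  u r t lambda <= U r.
Proof.
move=> l0 rt; apply: ub_le_sup; first exact: ubound_flow.
by exists lambda => //=; rewrite in_itv/= andbT.
Qed.

Lemma limit_flow_le r b : 0 <= r < t ->
  (forall lambda, 0 <= lambda -> u r t lambda <= b) -> U r <= b.
Proof.
move=> rt ub; apply: ge_sup.
  by exists (u r t 0), 0; rewrite //= in_itv/= lexx.
by move=> _ [l /= + <-]; rewrite in_itv/= andbT; exact: ub.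
Qed.

Lemma limit_flow_ge0 r : 0 <= r < t -> 0 <= U r.
Proof.
move=> rt; apply: le_trans (flow_le_limit (lexx 0) rt).
have [[u0 _ _] _] := flow_solution (ltW t0) (lexx 0).
by apply: u0; have /andP[-> /ltW] := rt.
Qed.

Lemma flow_at_infinityE r : 0 <= r < t ->
  (U r)%:E = flow_at_infinity u r t /\
  (U r)%:E = ((expR (xi r))%:E * flow_at_infinity (vflow xi u) r t)%E.
Proof.
move=> rt; have cvE (f : R -> R) l : f x @[x --> +oo] --> l ->
    lim ((f x)%:E @[x --> +oo]) = l%:E.
  by move=> fl; apply/cvg_lim => //; apply: cvg_EFin => //; exact: nearW.
split; first by rewrite /flow_at_infinity (cvE _ _ (flow_cvg rt)).
have vcvg : vflow xi u r t x @[x --> +oo] --> expR (- xi r) * U r.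
  apply: cvgMr.
  have lin : (expR (xi t) * x) @[x --> +oo] --> +oo.
    by apply: gt0_cvgMry; [exact: expR_gt0|exact: cvg_id].
  exact: (cvg_comp _ _ lin (flow_cvg rt)).
rewrite /flow_at_infinity (cvE _ _ vcvg) -EFinM mulrA -expRD subrr expR0.
by rewrite mul1r.
Qed.

(** Bounded convergence along integer terminal values: on [[0, s]] the solutions
    are bounded uniformly in the terminal value, and so are their drifts. *)
Lemma limit_flow_solution s : 0 <= s -> s < t -> integral_solution phi xi s U.
Proof.
move=> s0 st; have [B hB] := bounded st; have [K hK] := cadlag_bounded s0 cxi.
pose un (n : nat) r := u r t n%:R.
have un_cvg r : 0 <= r <= s -> un n r @[n --> \oo] --> U r.
  move=> /andP[r0 rs]; have rt : 0 <= r < t by rewrite r0 (le_lt_trans rs).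
  exact: (cvg_comp _ _ cvgr_idn (flow_cvg rt)).
have sun n : integral_solution phi xi s (un n).
  have [sn _] := flow_solution (ltW t0) (ler0n R n).
  exact: integral_solution_le (ltW st) sn.
have un0 n r : 0 <= r <= s -> 0 <= un n r by have [+ _ _] := sun n; apply.
have U0 r : 0 <= r <= s -> 0 <= U r.
  by move=> /andP[r0 rs]; apply: limit_flow_ge0; rewrite r0 (le_lt_trans rs).
have B0 : 0 <= B.
  have s00 : 0 <= (0 : R) <= s by rewrite lexx.
  by apply: le_trans (un0 0%N _ s00) _; apply: hB.
have [C hC] := drift_bounded cphi B0 hK.
have conv x y : 0 <= x -> x <= y -> y <= s ->
    mu.-integrable `]x, y] (EFin \o (fun r => drift r (U r))) /\
    \int[mu]_(r in `]x, y]) drift r (un n r) @[n --> \oo] -->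
    \int[mu]_(r in `]x, y]) drift r (U r).
  move=> x0 xy ys.
  have xys r : x < r <= y -> 0 <= r <= s.
    by move=> /andP[xr ry]; rewrite (le_trans x0 (ltW xr)) (le_trans ry).
  apply: (@bounded_convergence_itv _ (fun n r => drift r (un n r)) _ _ _ C).
  - move=> n; have [_ ui _] := sun n.
    have /measurable_int/measurable_EFinP := integrable_subitv x0 ys ui.
    exact.
  - move=> n r /xys rs; apply: hC => //; rewrite un0//= hB//.
  - by move=> r /xys rs; apply: drift_cvg => // [n||];
      [exact: un0|exact: U0|exact: un_cvg].
split => //; first by have [] := conv 0 s (lexx 0) s0 (lexx s).
move=> x y x0 xy ys; have [_ cv] := conv x y x0 xy ys.
have xs : 0 <= x <= s by rewrite x0 (le_trans xy).
have y_s : 0 <= y <= s by rewrite ys (le_trans x0).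
apply: (cvg_unique _ _ cv) => //.
have -> : (fun n => \int[mu]_(r in `]x, y]) drift r (un n r)) =
    (fun n => un n y - un n x).
  by apply/funext => n; have [_ _ ->] := sun n.
by apply: cvgB; exact: un_cvg.
Qed.

Lemma limit_flow_explosive : explosive_solution phi xi t U.
Proof.
split.
- by move=> r; rewrite in_itv/=; exact: limit_flow_ge0.
- apply/within_continuous_distP => p; rewrite /= in_itv/= => /andP[p0 pt] e e0.
  have [s ps st] : exists2 s, p < s & s < t.
    by exists ((p + t) / 2); lra.
  have s0 : 0 <= s by rewrite (le_trans p0)// ltW.
  have /within_continuous_distP cs :=
    integral_solution_continuous (limit_flow_solution s0 st).
  have [|d d0 hd] := cs p _ e e0; first by rewrite /= in_itv/= p0 ltW.
  exists (Num.min d (s - p)); first by rewrite lt_min d0 subr_gt0.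
  move=> q; rewrite /= in_itv/= lt_min => /andP[q0 _] /andP[qd qs].
  apply: hd => //; rewrite /= in_itv/= q0.
  by have := ler_norm (q - p); lra.
- move=> s; rewrite in_itv/= => /andP[s0 st].
  have [Us0 Ui Uinc] := limit_flow_solution s0 st.
  have [B hB] := bounded st; have [K hK] := cadlag_bounded s0 cxi.
  have UB r : 0 <= r <= s -> U r <= B.
    move=> /andP[r0 rs]; apply: limit_flow_le; first by rewrite r0 (le_lt_trans rs).
    by move=> l l0; rewrite hB// r0.
  have B0 : 0 <= B.
    have s00 : 0 <= (0 : R) <= s by rewrite lexx.
    exact: le_trans (Us0 0 s00) (UB 0 s00).
  have [C hC] := drift_bounded cphi B0 hK.
  apply: (@lipschitz_absolutely_continuous _ _ _ _ C) => x y x0 xy ys.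
  rewrite Uinc//; apply: integral_itv_norm_le => //.
    exact: integrable_subitv Ui.
  move=> r /andP[xr ry].
  have rs : 0 <= r <= s by rewrite (le_trans x0 (ltW xr)) (le_trans ry).
  by apply: hC => //; rewrite Us0// UB.
(* The times s n increase to t; each gives a null set of exceptions. *)
- pose s (n : nat) := t - t / n.+2%:R.
  have sP n : 0 <= s n < t.
    rewrite /s subr_ge0 ltrBlDr ltrDl divr_gt0// andbT.
    by rewrite ler_pdivrMr// ler_peMr ?ltW// ltr1n.
  have aes n : {ae mu, forall r, r \in `]0, s n[ ->
      is_derive r (1 : R) U (drift r (U r))}.
    have /andP[s0 st] := sP n; have [_ Ui Uinc] := limit_flow_solution s0 st.
    exact: integral_increments_derive Ui Uinc.
  have : {ae mu, forall r n, r \in `]0, s n[ ->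
      is_derive r (1 : R) U (drift r (U r))}.
    exact: ae_foralln.
  apply: filterS; first exact: (ae_filter_ringOfSetsType mu).
  move=> r hr; rewrite in_itv/= => /andP[r0 rt].
  pose n := Num.truncn (t / (t - r)).
  apply: (hr n); rewrite in_itv/= r0/= /s.
  have tr : 0 < t - r by rewrite subr_gt0.
  rewrite ltrBrDl -ltrBrDr ltr_pdivrMr// mulrC -ltr_pdivrMr//.
  have /truncn_itv/andP[_ h] : 0 <= t / (t - r) by rewrite divr_ge0// ltW.
  by rewrite (lt_trans h)// ltr_nat.
- apply/cvgryPge => M; pose l := Num.max M 0 + 1.
  have l0 : 0 <= l by rewrite addr_ge0// le_max lexx orbT.
  have [su ut] := flow_solution (ltW t0) l0.
  have /within_continuous_distP cu := integral_solution_continuous su.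
  have [|d d0 hd] := cu t _ 1 ltr01; first by rewrite /= in_itv/= lexx ltW.
  near=> r.
  have rt : r < t by near: r; exact: nbhs_left_lt.
  have r0 : 0 <= r by near: r; exact: nbhs_left_ge.
  have rd : t - r < d by near: r; exact: nbhs_left_ltBl.
  apply: (@le_trans _ _ (u r t l)); last by rewrite flow_le_limit// r0.
  have := hd r; rewrite /= in_itv/= r0 (ltW rt) distrC gtr0_norm ?subr_gt0//.
  move=> /(_ isT rd); rewrite ut ltr_norml => /andP[+ _].
  have : M <= Num.max M 0 by rewrite le_max lexx.
  by rewrite /l; lra.
Unshelve. all: by end_near. Qed.

(** A backward solution is bounded on [[0, t]] while [w] explodes at [t], so the
    two are ordered at some [q < t] and comparison applies on [[0, q]]. *)
Lemma limit_flow_minimal w : explosive_solution phi xi t w ->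
  {in `[0, t[, forall r, U r <= w r}.
Proof.
move=> ew r; rewrite in_itv/= => /andP[r0 rt].
apply: limit_flow_le => [|l l0]; first by rewrite r0.
have [su ut] := flow_solution (ltW t0) l0.
have [c _ hc] := EVT_max (ltW t0) (integral_solution_continuous su).
have [_ _ _ _ /cvgryPge wy] := ew.
near (t^'-) => q.
have qt : q < t by near: q; exact: nbhs_left_lt.
have rq : r <= q by near: q; exact: nbhs_left_ge.
have cq : u c t l <= w q by near: q; exact: wy.
have q0 := le_trans r0 rq.
have sw := explosive_integral_solution cphi cxi q0 qt ew.
apply: (unique_solution_comparison q0 (ltW qt) (uniq (ltW t0) l0) sw).
  by apply: le_trans cq; apply: hc; rewrite in_itv/= q0 ltW.
by rewrite r0.
Unshelve. all: by end_near. Qed.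

End flow_at_infinity.

Theorem corollary4p2 (R : realType)
    (b c : R) (m : {measure set R -> \bar R})
    (d : measure_display) (Omega : measurableType d) (P : probability Omega R)
    (F : R -> set (set Omega))
    (a sigma : R) (B : R -> Omega -> R) (nu : {measure set R -> \bar R})
    (N : Omega -> {measure set (R * R) -> \bar R})
    (xi : R -> Omega -> R) (u : Omega -> R -> R -> R -> R) :
  branching_parameters c m ->
  usual_filtration P F ->
  levy_environment P F a sigma B nu N xi ->
  (forall (w : Omega) (t lambda : R), 0 <= t -> 0 <= lambda ->
     unique_positive_backward_solution (branching_mechanism b c m)
       (xi ^~ w) t lambda (fun r => u w r t lambda)) ->
  grey_condition (branching_mechanism b c m) ->
  forall (w : Omega) (t : R), 0 < t ->
  exists2 U : R -> R,
    {in `[0, t[, forall r,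
       (U r)%:E = flow_at_infinity (u w) r t /\
       (U r)%:E = ((expR (xi r w))%:E *
                   flow_at_infinity (vflow (xi ^~ w) (u w)) r t)%E} &
    minimal_explosive_solution (branching_mechanism b c m) (xi ^~ w) t U.
Proof.
move=> bcm _ [[_ cxi _ _] _ _ _ _] uniq gr w t t0.
set phi := branching_mechanism b c m in uniq gr *.
have cphi : continuous (phi \o Num.max 0) := branching_mechanism_continuous bcm.
have st : star_shaped phi := branching_mechanism_star b bcm.
have [A [A0 hom iA]] := grey_positive st gr.
have [K hK] := cadlag_bounded (ltW t0) (cxi w).
have bounded s : s < t -> exists B, forall lambda r,
    0 <= lambda -> 0 <= r <= s -> u w r t lambda <= B.
  move=> lst; have [B0 hB] := integral_solution_bound st cphi A0 hom iA hK lst.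
  exists B0 => l r l0 rs; have [sl _] := flow_solution (uniq w) (ltW t0) l0.
  exact: (hB _ sl).
exists (limit_flow (u w) t).
  by move=> r; rewrite in_itv/=; exact: (flow_at_infinityE (uniq w) bounded).
split; first exact: (limit_flow_explosive cphi (cxi w) (uniq w) t0 bounded).
exact: (limit_flow_minimal cphi (cxi w) (uniq w) t0).
Qed.
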